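(* For every $\epsilon>0$ there exists a constant $c(\epsilon)>0$, depending only on $\epsilon$, such that for every $n\ge1$ and every flower $F\subseteq\mathbb{R}^n$ with $F=-F$ there exists a linear subspace $E\subseteq\mathbb{R}^n$ of dimension $\dim E\ge c(\epsilon)\cdot n$ such that $$d\left(P_EF,B_2^E\right)\le1+\epsilon .$$
   Context: For $x\in\mathbb{R}^n$ let $B_x$ be the closed Euclidean ball with center $x/2$ and radius $|x|/2$. A flower is a set of the form $\bigcup_{x\in A}B_x$ for some $A\subseteq\mathbb{R}^n$; flowers are assumed compact with the origin in their interior. $P_E$ is the orthogonal projection onto $E$, $B_2^n$ is the closed Euclidean unit ball and $B_2^E=B_2^n\cap E$. The geometric distance of two star bodies $A,B$ (in the same space) is $d(A,B)=\inf\{ab:\ a,b>0,\ \frac1aA\subseteq B\subseteq bA\}$. *)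

(* Defs.v *)
From HB Require Import structures.
From mathcomp Require Import all_boot all_order all_algebra.
From mathcomp Require Import all_classical all_reals all_analysis.

Set Implicit Arguments.
Unset Strict Implicit.
Unset Printing Implicit Defensive.

Import Order.TTheory GRing.Theory Num.Theory.
Import numFieldNormedType.Exports.

Local Open Scope classical_set_scope.
Local Open Scope ring_scope.

Section Flowers.
Context {R : realType} {n : nat}.
Implicit Types (x y p : 'rV[R]_n) (A B F : set 'rV[R]_n) (E : {vspace 'rV[R]_n}).

Definition dotv x y : R := \sum_(i < n) x 0 i * y 0 i.

(* The library norm on row vectors is the sup norm, hence a separate
   Euclidean norm; both induce the library topology of 'rV[R]_n. *)
Definition enorm x : R := Num.sqrt (dotv x x).

Definition petal x : set 'rV[R]_n :=
  [set y | enorm (y - 2^-1 *: x) <= enorm x / 2].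

Definition flower F : Prop :=
  [/\ exists A, F = \bigcup_(x in A) petal x,
      compact F
    & interior F 0].

Definition is_orth_proj E x p : Prop :=
  p \in E /\ forall e, e \in E -> dotv (x - p) e = 0.

Definition orth_proj_image E F : set 'rV[R]_n :=
  [set p | exists2 x, F x & is_orth_proj E x p].

Definition eball E : set 'rV[R]_n :=
  [set x | enorm x <= 1] `&` [set x | x \in E].

(* The infimum is taken in \bar R so that it is +oo, not a junk real value,
   when no pair (a, b) is admissible. *)
Definition geom_dist A B : \bar R :=
  ereal_inf [set r | exists a b : R,
    [/\ 0 < a, 0 < b,
        [set a^-1 *: x | x in A] `<=` B,
        B `<=` [set b *: x | x in A]
      & r = (a * b)%:E]].

End Flowers.

(* Main.v *)
Require Import Defs.
From mathcomp Require Import all_boot all_order all_algebra.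
From mathcomp Require Import all_classical all_reals all_analysis.
From mathcomp Require Import ring lra zify.

Import Order.TTheory GRing.Theory Num.Theory.
Import numFieldNormedType.Exports.

Local Open Scope classical_set_scope.
Local Open Scope ring_scope.

(* If r = sup |x| over the points x spanning the flower, then
   q(th) = sup (|<x, th>| + |x| |th|) / r is a norm with |th| <= q <= 2 |th|,
   and q r / 2 is the support function of F. Such a norm is almost a multiple
   of the Euclidean norm on a subspace E of dimension proportional to n
   (Dvoretzky-Milman). On E the petals nearly realizing the support function in
   a direction th project to balls whose centers nearly point along th, so the
   star-shaped set P_E F itself, not just its convex hull, is almost a ball.

   The subspace is the row space of a random k x n matrix whose entries are
   normalized sums of N independent signs. For fixed u, q(u G) is a convex
   Lipschitz function of the signs and concentrates by Maurey's
   inf-convolution inequality; as N grows its mean tends, by Lindeberg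
   swapping, to a multiple of |u|; a net of the unit ball of exponential size
   does the rest. *)

(** * Euclidean norm and seminorms *)

(** The dimension in Dvoretzky-Milman is governed by the ratio of the mean of the norm to its
    Lipschitz constant. For a general convex body this ratio can be small; here the term |x| |th|,
    present in every direction, forces q >= |th|, so the ratio is bounded below and the dimension is
    linear in n.

    Signs make every expectation a finite average, but they lose rotation invariance: the mean of
    q(u G) depends on the direction of u. Invariance returns only as N grows, at a rate depending on
    n, k and q. This costs nothing in the final constant, because the concentration bounds do not
    involve N, which can therefore be taken as large as needed once n and q are known.

    Nor is u -> u G an exact multiple of an isometry, so one matrix has to control |u G| and q(u G)
    at once; their ratio is what the subspace sees. *)

Section EuclideanNorm.
Context {R : realType}.

(** Stated over a sequence because it is also applied to coefficients zipped with a list of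
    steps. *)
Lemma cauchy_schwarz_seq (T : Type) (r : seq T) (a b : T -> R) :
  (\sum_(i <- r) a i * b i) ^+ 2 <=
  (\sum_(i <- r) a i ^+ 2) * (\sum_(i <- r) b i ^+ 2).
Proof.
elim: r => [|x r IH]; first by rewrite !big_nil expr0n mul0r.
rewrite !big_cons; set S := \sum_(i <- r) a i * b i in IH *.
have hX : 0 <= \sum_(i <- r) a i ^+ 2 by apply: sumr_ge0 => i _; apply: sqr_ge0.
have hY : 0 <= \sum_(i <- r) b i ^+ 2 by apply: sumr_ge0 => i _; apply: sqr_ge0.
set X := \sum_(i <- r) a i ^+ 2 in IH hX *.
set Y := \sum_(i <- r) b i ^+ 2 in IH hY *.
suff : 2 * (S * (a x * b x)) <= X * b x ^+ 2 + Y * a x ^+ 2 by lra.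
have hZ : 0 <= X * b x ^+ 2 + Y * a x ^+ 2.
  by rewrite addr_ge0 // mulr_ge0 // sqr_ge0.
apply: le_trans (ler_norm _) _.
rewrite -ler_sqr ?nnegrE // real_normK ?num_real //.
have h2 : S ^+ 2 * (a x * b x) ^+ 2 <= X * Y * (a x * b x) ^+ 2.
  by rewrite ler_wpM2r // sqr_ge0.
have := sqr_ge0 (X * b x ^+ 2 - Y * a x ^+ 2); lra.
Qed.

Context {n : nat}.
Implicit Types x y z : 'rV[R]_n.

Lemma dotvC x y : dotv x y = dotv y x.
Proof. by apply: eq_bigr => i _; rewrite mulrC. Qed.

Lemma dotvDl x y z : dotv (x + y) z = dotv x z + dotv y z.
Proof. by rewrite /dotv -big_split; apply: eq_bigr => i _; rewrite mxE mulrDl. Qed.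

Lemma dotvZl a x z : dotv (a *: x) z = a * dotv x z.
Proof. by rewrite /dotv mulr_sumr; apply: eq_bigr => i _; rewrite mxE mulrA. Qed.

Lemma dotvNl x z : dotv (- x) z = - dotv x z.
Proof. by rewrite -scaleN1r dotvZl mulN1r. Qed.

Lemma dotvDr z x y : dotv z (x + y) = dotv z x + dotv z y.
Proof. by rewrite dotvC dotvDl !(dotvC z). Qed.

Lemma dotvZr a z x : dotv z (a *: x) = a * dotv z x.
Proof. by rewrite dotvC dotvZl dotvC. Qed.

Lemma dotvNr z x : dotv z (- x) = - dotv z x.
Proof. by rewrite dotvC dotvNl dotvC. Qed.

Lemma dotv0l x : dotv 0 x = 0.
Proof. by rewrite -(scale0r 0) dotvZl mul0r. Qed.

Lemma dotv_suml (T : Type) (r : seq T) (w : T -> 'rV[R]_n) y :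
  dotv (\sum_(i <- r) w i) y = \sum_(i <- r) dotv (w i) y.
Proof.
elim: r => [|i r IH]; first by rewrite !big_nil dotv0l.
by rewrite !big_cons dotvDl IH.
Qed.

Lemma dotv_ge0 x : 0 <= dotv x x.
Proof. by apply: sumr_ge0 => i _; rewrite -expr2 sqr_ge0. Qed.

Lemma enorm_ge0 x : 0 <= enorm x.
Proof. exact: sqrtr_ge0. Qed.
Hint Resolve enorm_ge0 : core.

Lemma sqr_enorm x : enorm x ^+ 2 = dotv x x.
Proof. by rewrite sqr_sqrtr // dotv_ge0. Qed.

Lemma dotv_delta x i : dotv (delta_mx 0 i) x = x 0 i.
Proof.
rewrite /dotv (bigD1 i) //= big1 ?addr0 => [|j hj]; first by rewrite mxE !eqxx mul1r.
by rewrite mxE (negbTE hj) andbF mul0r.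
Qed.

Lemma enorm_delta i : enorm (delta_mx 0 i : 'rV[R]_n) = 1.
Proof. by rewrite /enorm dotv_delta mxE !eqxx sqrtr1. Qed.

Lemma ler_dotv x y : `|dotv x y| <= enorm x * enorm y.
Proof.
rewrite -ler_sqr ?nnegrE ?mulr_ge0 // real_normK ?num_real // exprMn !sqr_enorm.
have sqE z : dotv z z = \sum_(i < n) z 0 i ^+ 2 by apply: eq_bigr => i _; rewrite expr2.
by rewrite !sqE; apply: cauchy_schwarz_seq.
Qed.

Lemma ler_enormD x y : enorm (x + y) <= enorm x + enorm y.
Proof.
rewrite -ler_sqr ?nnegrE ?addr_ge0 // sqr_enorm dotvDl !dotvDr (dotvC y x) sqrrD.
rewrite !sqr_enorm; have := ler_dotv x y; rewrite ler_norml; lra.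
Qed.

Lemma enormZ a x : enorm (a *: x) = `|a| * enorm x.
Proof. by rewrite /enorm dotvZl dotvZr mulrA -expr2 sqrtrM ?sqr_ge0 // sqrtr_sqr. Qed.

Lemma enorm0 : enorm (0 : 'rV[R]_n) = 0.
Proof. by rewrite /enorm dotv0l sqrtr0. Qed.

Lemma enormN x : enorm (- x) = enorm x.
Proof. by rewrite -scaleN1r enormZ normrN normr1 mul1r. Qed.

Lemma enorm_eq0 x : enorm x = 0 -> x = 0.
Proof.
move=> h; have : dotv x x = 0 by rewrite -sqr_enorm h expr0n.
move/eqP; rewrite psumr_eq0 => [/allP h0|i _]; last by rewrite -expr2 sqr_ge0.
apply/rowP => i; rewrite mxE; apply/eqP.
by have := h0 i (mem_index_enum i); rewrite /= -expr2 sqrf_eq0.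
Qed.

Lemma enorm_gt0 x : x != 0 -> 0 < enorm x.
Proof. by move=> h; rewrite lt_neqAle enorm_ge0 andbT eq_sym; apply: contra_neq h; apply: enorm_eq0. Qed.

Lemma ler_norm_enorm x i : `|x 0 i| <= enorm x.
Proof. by rewrite -dotv_delta (le_trans (ler_dotv _ _)) // enorm_delta mul1r. Qed.

End EuclideanNorm.
#[local] Hint Resolve enorm_ge0 : core.

Section Seminorm.
Context {R : realType} {V : lmodType R}.

Definition seminorm (q : V -> R) : Prop :=
  (forall x y, q (x + y) <= q x + q y) /\ (forall a x, q (a *: x) = `|a| * q x).

Context {q : V -> R} (hq : seminorm q).

Lemma seminorm0 : q 0 = 0.
Proof. by rewrite -(scale0r 0) hq.2 normr0 mul0r. Qed.

Lemma seminormN x : q (- x) = q x.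
Proof. by rewrite -scaleN1r hq.2 normrN normr1 mul1r. Qed.

Lemma seminorm_ge0 x : 0 <= q x.
Proof. by have := hq.1 x (- x); rewrite subrr seminorm0 seminormN; lra. Qed.

Lemma seminormB x y : q x <= q y + q (x - y).
Proof. by have := hq.1 y (x - y); rewrite addrC subrK. Qed.

End Seminorm.

Lemma seminorm_enorm {R : realType} {n : nat} : seminorm (@enorm R n).
Proof. by split; [apply: ler_enormD | apply: enormZ]. Qed.
(** * Convex concentration for random signs *)

Section Averages.
Context {R : realType} {V : lmodType R}.
Implicit Types (f g : V -> R) (v w : V) (ws : seq V).

Definition avg1 w f v : R := (f (v + w) + f (v - w)) / 2.

(* [avg ws f v] is the expectation of f (v + sum of +-w, w in ws) over
   independent uniform signs. *)
Definition avg ws f : V -> R := foldr avg1 f ws.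

Lemma avg_cat ws1 ws2 f : avg (ws1 ++ ws2) f = avg ws1 (avg ws2 f).
Proof. exact: foldr_cat. Qed.

Lemma avg1_le w f g v : (forall x, f x <= g x) -> avg1 w f v <= avg1 w g v.
Proof. by move=> h; rewrite /avg1 ler_wpM2r ?invr_ge0 // lerD. Qed.

Lemma avg_le ws f g v : (forall x, f x <= g x) -> avg ws f v <= avg ws g v.
Proof. by move=> h; elim: ws v => [|w ws IH] v //=; apply: avg1_le. Qed.

Lemma avg_cst ws (c : R) v : avg ws (fun=> c) v = c.
Proof. by elim: ws v => [|w ws IH] v //=; rewrite /avg1 !IH; field. Qed.

Lemma eq_avg ws f g v : (forall x, f x = g x) -> avg ws f v = avg ws g v.
Proof. by move=> /funext ->. Qed.

Lemma avgD ws f g v : avg ws (fun x => f x + g x) v = avg ws f v + avg ws g v.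
Proof. by elim: ws v => [|w ws IH] v //=; rewrite /avg1 !IH; field. Qed.

Lemma avgM ws (c : R) f v : avg ws (fun x => c * f x) v = c * avg ws f v.
Proof. by elim: ws v => [|w ws IH] v //=; rewrite /avg1 !IH; field. Qed.

Lemma avg_sum (I : Type) (r : seq I) (P : pred I) ws (F : I -> V -> R) v :
  avg ws (fun x => \sum_(i <- r | P i) F i x) v = \sum_(i <- r | P i) avg ws (F i) v.
Proof.
elim: r => [|i r IH].
  rewrite big_nil; apply: etrans (avg_cst ws 0 v); apply: eq_avg => x.
  by rewrite big_nil.
rewrite big_cons -IH; case: ifP => h.
  by rewrite -avgD; apply: eq_avg => x; rewrite big_cons h.
by apply: eq_avg => x; rewrite big_cons h.
Qed.

Lemma avg_dist ws f g (c : R) v :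
  (forall x, `|f x - g x| <= c) -> `|avg ws f v - avg ws g v| <= c.
Proof.
move=> h; have h1 : avg ws f v <= avg ws g v + c.
  by rewrite -[c in _ + c](avg_cst ws c v) -avgD; apply: avg_le => x;
     have := h x; rewrite ler_norml; lra.
have h2 : avg ws g v <= avg ws f v + c.
  by rewrite -[c in _ + c](avg_cst ws c v) -avgD; apply: avg_le => x;
     have := h x; rewrite ler_norml; lra.
by rewrite ler_norml; lra.
Qed.

(** Fubini for signs: it makes the first sign the innermost average, where the two-point inequality
    applies. *)
Lemma avg1_avgC w ws f : avg1 w (avg ws f) = avg ws (avg1 w f).
Proof.
elim: ws => [|x ws IH] //=; rewrite -IH; apply/funext => v; rewrite /avg1.
by rewrite -!addrA (addrC w x) (addrC (- w) x) (addrC w (- x)) (addrC (- w) (- x)); field.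
Qed.

(** The first-moment method, which later extracts a good matrix from an average. *)
Lemma avg_lt_exists ws f (c : R) v : avg ws f v < c -> exists x, f x < c.
Proof.
elim: ws v => [|w ws IH] v /=; first by exists v.
rewrite /avg1 => h; have [h1|h1] := ltP (avg ws f (v + w)) c; first exact: IH h1.
by apply: (IH (v - w)); lra.
Qed.

End Averages.

Lemma avg_map {R : realType} {V W : lmodType R} (L : V -> W) (ws : seq V) (f : W -> R) v :
  (forall x y, L (x + y) = L x + L y) -> (forall x, L (- x) = - L x) ->
  avg ws (fun x => f (L x)) v = avg (map L ws) f (L v).
Proof.
by move=> hD hN; elim: ws v => [|w ws IH] v //=; rewrite /avg1 !IH !hD hN.
Qed.

Section ConvexConcentration.
Context {R : realType}.

Lemma expR_convex (a b t : R) : 0 <= t <= 1 ->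
  expR ((1 - t) * a + t * b) <= (1 - t) * expR a + t * expR b.
Proof.
move=> /andP[t0 t1]; set m := (1 - t) * a + t * b.
have h x : expR m * (1 + (x - m)) <= expR x.
  have -> : expR x = expR m * expR (x - m) by rewrite -expRD addrC subrK.
  by rewrite ler_wpM2l ?expR_ge0 // expR_ge1Dx.
have ha := ler_wpM2l (_ : 0 <= 1 - t) (h a).
have hb := ler_wpM2l t0 (h b).
have {}ha := ha ltac:(lra).
apply: le_trans (lerD ha hb).
by rewrite le_eqVlt; apply/orP; left; apply/eqP; rewrite /m; ring.
Qed.

Lemma expR_le_quadratic (x : R) : x <= 2^-1 -> expR x <= 1 + x + 2 * x ^+ 2.
Proof.
move=> hx; have h1 : 0 < 1 - x by lra.
have h2 : expR x <= (1 - x)^-1.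
  rewrite -[x in expR x]opprK expRN lef_pV2 ?posrE ?expR_gt0 //.
  by have := expR_ge1Dx (- x); lra.
apply: le_trans h2 _; rewrite -[_^-1]mul1r ler_pdivrMr //.
have := mulr_ge0 (sqr_ge0 x) (_ : 0 <= 1 - 2 * x); move/(_ ltac:(lra)); rewrite !expr2; nra.
Qed.

Lemma expRN_le (x : R) : 0 <= x -> expR (- x) <= (1 + x)^-1.
Proof. by move=> hx; rewrite expRN lef_pV2 ?posrE ?expR_gt0 ?expR_ge1Dx //; lra. Qed.

(** Here [d] is the gap between the two values of a convex function and [E] the change made by
    inf-convolution at the larger one. *)
Lemma two_point_aux (d E : R) : 0 <= d ->
  (forall t, 0 <= t <= 1 -> E <= - t * d + t ^+ 2 / 32) ->
  expR E * (1 + expR d) + expR (- d) + 1 <= 4.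
Proof.
move=> d0 hE; have [hd|hd] := leP d (1 / 8).
  (* The choice t = 8 d gives E <= - 6 d ^ 2; for d > 1 / 8 the full move t = 1 is used. *)
  have /hE hE8 : 0 <= 8 * d <= 1 by lra.
  have h1 : expR E <= (1 + 6 * d ^+ 2)^-1.
    apply: le_trans (expRN_le _ _); last by rewrite mulr_ge0 // sqr_ge0.
    by rewrite ler_expR; apply: le_trans hE8 _; rewrite !expr2; lra.
  have h2 := expR_le_quadratic d ltac:(lra).
  have h3 := expR_le_quadratic (- d) ltac:(lra).
  have hp : 0 < 1 + 6 * d ^+ 2 by have := sqr_ge0 d; lra.
  suff : (1 + 6 * d ^+ 2)^-1 * (2 + d + 2 * d ^+ 2) <= 2 + d - 2 * d ^+ 2.
    have : expR E * (1 + expR d) <= (1 + 6 * d ^+ 2)^-1 * (2 + d + 2 * d ^+ 2).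
      by apply: ler_pM; rewrite ?expR_ge0 ?addr_ge0 ?expR_ge0 //; lra.
    by move: h3; rewrite sqrrN; lra.
  rewrite mulrC ler_pdivrMr //.
  have h4 : 0 <= d ^+ 2 * (8 + 6 * d - 12 * d ^+ 2).
    rewrite mulr_ge0 ?sqr_ge0 //; suff : d ^+ 2 <= 1 / 64 by lra.
    by rewrite expr2; nra.
  by move: h4; rewrite !expr2; lra.
have /hE hE1 : 0 <= (1 : R) <= 1 by lra.
have h1 : expR E <= expR (- d) * (1 + 1 / 32 + 2 * (1 / 32) ^+ 2).
  apply: le_trans (_ : expR (- d + 1 / 32) <= _); first by rewrite ler_expR; lra.
  by rewrite expRD ler_wpM2l ?expR_ge0 // expR_le_quadratic //; lra.
have h2 : expR (- d) <= 8 / 9.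
  apply: le_trans (expRN_le _ d0) _; rewrite -[_^-1]mul1r ler_pdivrMr; lra.
have h3 := expRxMexpNx_1 d.
have h4 := ler_wpM2r (_ : 0 <= 1 + expR d) h1.
have {h4} := h4 (addr_ge0 ler01 (expR_ge0 d)).
have := expR_ge0 (- d); rewrite expr2; nra.
Qed.

(** Property (tau) of one fair sign: [al], [be] are the values of a convex function at the two signs
    and [qa], [qb] those of its inf-convolution. Only the larger value has to gain; at the smaller
    one t = 0. *)
Lemma two_point (al be qa qb : R) :
  (forall t, 0 <= t <= 1 -> qa <= (1 - t) * al + t * be + t ^+ 2 / 32) ->
  (forall t, 0 <= t <= 1 -> qb <= (1 - t) * be + t * al + t ^+ 2 / 32) ->
  (expR qa + expR qb) / 2 * ((expR (- al) + expR (- be)) / 2) <= 1.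
Proof.
wlog hab : al be qa qb / be <= al => [hw ha hb|ha hb].
  have [h|h] := leP be al; first exact: hw.
  by have := hw be al qb qa (ltW h) hb ha; lra.
have hqb : qb <= be by have := hb 0 ltac:(lra); rewrite expr2; lra.
have haux : expR (qa - al) * (1 + expR (al - be)) + expR (- (al - be)) + 1 <= 4.
  apply: two_point_aux => [|t ht]; first lra.
  by have := ha t ht; lra.
have e1 : expR (- be) = expR (- al) * expR (al - be) by rewrite -expRD; congr expR; ring.
have e2 : expR (qa - al) = expR qa * expR (- al) by rewrite -expRD.
have e3 : expR qb * (expR (- al) + expR (- be)) <= expR (- (al - be)) + 1.
  rewrite mulrDr -!expRD; apply: lerD; first by rewrite ler_expR; lra.
  by rewrite -[leRHS](@expR0 R) ler_expR; lra.
by move: haux; rewrite e2 e1; move: e3; rewrite e1; lra.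
Qed.

Context {V : lmodType R}.

Definition convexf (f : V -> R) : Prop := forall x y (t : R), 0 <= t <= 1 ->
  f ((1 - t) *: x + t *: y) <= (1 - t) * f x + t * f y.

(* The cost s ^+ 2 / 128 is that of [two_point]: moving from the sign 1 a
   fraction t of the way to -1 is a shift s = -2 t, of cost t ^+ 2 / 32. *)
Definition infconv (w : V) (f : V -> R) (v : V) : R :=
  inf [set f (v + s *: w) + s ^+ 2 / 128 | s in [set: R]].

Section InfConvolution.
Variables (w : V) (f : V -> R).
Hypotheses (f0 : forall v, 0 <= f v) (fc : convexf f).

(** [f0] bounds the set below, so that [inf] is a true infimum and not a default value. *)
Lemma infconv_le v s : infconv w f v <= f (v + s *: w) + s ^+ 2 / 128.
Proof.
apply: ge_inf; last by exists s.
by exists 0 => _ [s' _ <-]; rewrite addr_ge0 // divr_ge0 ?sqr_ge0.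
Qed.

Lemma infconv_ge v c :
  (forall s, c <= f (v + s *: w) + s ^+ 2 / 128) -> c <= infconv w f v.
Proof.
move=> h; apply: lb_le_inf => [|_ [s _ <-]] //.
by exists (f (v + 0 *: w) + 0 ^+ 2 / 128); exists 0.
Qed.

Lemma infconv_ge0 v : 0 <= infconv w f v.
Proof. by apply: infconv_ge => s; rewrite addr_ge0 // divr_ge0 ?sqr_ge0. Qed.

(** The expression f (x + s w) + s ^ 2 / 128 is jointly convex in (x, s), and partial infima of
    jointly convex functions are convex. *)
Lemma infconv_convex : convexf (infconv w f).
Proof.
move=> x y t /andP[t0 t1].
have h s s' : infconv w f ((1 - t) *: x + t *: y) <=
    (1 - t) * (f (x + s *: w) + s ^+ 2 / 128) + t * (f (y + s' *: w) + s' ^+ 2 / 128).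
  apply: le_trans (infconv_le _ ((1 - t) * s + t * s')) _.
  have -> : (1 - t) *: x + t *: y + ((1 - t) * s + t * s') *: w =
      (1 - t) *: (x + s *: w) + t *: (y + s' *: w).
    by rewrite !scalerDr [(_ + t * _) *: w]scalerDl !scalerA addrACA.
  have hf := fc (x + s *: w) (y + s' *: w) t ltac:(lra).
  have : 0 <= (1 - t) * t * (s - s') ^+ 2 by rewrite mulr_ge0 ?sqr_ge0 // mulr_ge0; lra.
  by move: hf; rewrite !expr2; lra.
(* The two infima are taken one after the other; each time the weight is divided out, so weight 0 is
   treated apart. *)
have h1 s' : infconv w f ((1 - t) *: x + t *: y) <=
    (1 - t) * infconv w f x + t * (f (y + s' *: w) + s' ^+ 2 / 128).
  have [te|tn1] := eqVneq t 1; first by have := h 0 s'; rewrite te subrr !mul0r.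
  have t1' : 0 < 1 - t by rewrite subr_gt0 lt_neqAle tn1.
  rewrite -lerBlDr -ler_pdivrMl //; apply: infconv_ge => s.
  by rewrite ler_pdivrMl // lerBlDr; apply: h.
have [t00|tn0] := eqVneq t 0; first by have := h1 0; rewrite t00 !mul0r.
have t0' : 0 < t by rewrite lt_neqAle eq_sym tn0.
rewrite -lerBlDl -ler_pdivrMl //; apply: infconv_ge => s.
by rewrite ler_pdivrMl // lerBlDl; apply: h1.
Qed.

End InfConvolution.

Definition ln_avg1 (w : V) (q : V -> R) (v : V) : R := ln (avg1 w (fun x => expR (q x)) v).

Lemma expR_ln_avg1 w q v : expR (ln_avg1 w q v) = avg1 w (fun x => expR (q x)) v.
Proof. by rewrite lnK // posrE divr_gt0 // addr_gt0 // expR_gt0. Qed.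

(** Convexity of log-sum-exp without Hölder: subtracting A and B normalizes both averages to 1, and
    pointwise convexity of exp can then be averaged over the sign. *)
Lemma ln_avg1_convex w q : convexf q -> convexf (ln_avg1 w q).
Proof.
move=> qc x y t ht; rewrite -ler_expR expR_ln_avg1.
set A := ln_avg1 w q x; set B := ln_avg1 w q y.
have hA : (expR (q (x + w) - A) + expR (q (x - w) - A)) / 2 = 1.
  by rewrite !expRB expR_ln_avg1 -/A /avg1; field; rewrite gt_eqF // addr_gt0 ?expR_gt0.
have hB : (expR (q (y + w) - B) + expR (q (y - w) - B)) / 2 = 1.
  by rewrite !expRB expR_ln_avg1 -/B /avg1; field; rewrite gt_eqF // addr_gt0 ?expR_gt0.
clearbody A B.
have h z : expR (q ((1 - t) *: x + t *: y + z)) <= expR ((1 - t) * A + t * B) *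
    ((1 - t) * expR (q (x + z) - A) + t * expR (q (y + z) - B)).
  apply: le_trans (_ : expR ((1 - t) * q (x + z) + t * q (y + z)) <= _).
    rewrite ler_expR; apply: le_trans (qc _ _ _ ht).
    by rewrite !scalerDr addrACA -scalerDl subrK scale1r.
  apply: le_trans (ler_wpM2l (expR_ge0 _) (expR_convex _ _ _ ht)).
  rewrite -expRD ler_expR; move: (q (x + z)) (q (y + z)) => a b; lra.
have h1 := h w; have h2 := h (- w); rewrite /avg1; move: h1 h2 hA hB.
move: (expR (q (x + w) - A)) (expR (q (x - w) - A)) => a1 a2.
move: (expR (q (y + w) - B)) (expR (q (y - w) - B)) => b1 b2.
move: (expR ((1 - t) * A + t * B)) (expR (q (_ + w))) (expR (q (_ - w))) => M c1 c2.
move=> h1 h2 hA hB.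
have : M * ((1 - t) * ((a1 + a2) / 2) + t * ((b1 + b2) / 2)) = M by rewrite hA hB; ring.
lra.
Qed.

(* Maurey's property (tau) for random signs, with g below the inf-convolution
   of f. Induction on the signs works because both [infconv w] and
   ln E exp along one sign preserve convexity. *)
Lemma exp_infconv_product (ws : seq V) (f g : V -> R) (v : V) :
  (forall x, 0 <= f x) -> convexf f ->
  (forall x (s : seq R), size s = size ws ->
     g x <= f (x + \sum_(p <- zip s ws) p.1 *: p.2) + (\sum_(a <- s) a ^+ 2) / 128) ->
  avg ws (fun x => expR (g x)) v * avg ws (fun x => expR (- f x)) v <= 1.
Proof.
elim: ws f g v => [|w ws IH] f g v f0 fc hg.
  rewrite /= -expRD -[leRHS](@expR0 R) ler_expR.
  by have := hg v [::] erefl; rewrite !big_nil addr0 mul0r addr0; lra.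
rewrite /= !avg1_avgC.
pose q := infconv w f; pose phi := ln_avg1 w q.
have q0 := infconv_ge0 w f f0; have qc := infconv_convex w f f0 fc.
(* [IH] handles the remaining signs with [phi] for f and [ln_avg1 w g] for g; the two-point
   inequality bounds the average of exp (- f) along [w] by exp (- phi). *)
apply: le_trans (IH phi (ln_avg1 w g) v _ (ln_avg1_convex w q qc) _); first last.
- move=> x s hs; rewrite -ler_expR expRD !expR_ln_avg1 /avg1.
  have h z : expR (g (x + z)) <= expR (q (x + \sum_(p <- zip s ws) p.1 *: p.2 + z)) *
      expR ((\sum_(a <- s) a ^+ 2) / 128).
    rewrite -expRD ler_expR -lerBlDr; apply: infconv_ge => t.
    have := hg (x + z) (t :: s); rewrite /= hs => /(_ erefl); rewrite !big_cons /=.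
    have -> : x + z + (t *: w + \sum_(p <- zip s ws) p.1 *: p.2) =
      x + \sum_(p <- zip s ws) p.1 *: p.2 + z + t *: w.
      by rewrite -!addrA; congr (_ + _); rewrite [LHS]addrA [LHS]addrC.
    lra.
  by have := h w; have := h (- w); lra.
- move=> x; rewrite -ler_expR expR0 expR_ln_avg1 /avg1.
  by have := expR_ge1Dx (q (x + w)); have := expR_ge1Dx (q (x - w));
     have := q0 (x + w); have := q0 (x - w); rewrite -/q; lra.
apply: ler_pM.
- by rewrite -(avg_cst ws 0 v); apply: avg_le => x; rewrite divr_ge0 // addr_ge0 // expR_ge0.
- by rewrite -(avg_cst ws 0 v); apply: avg_le => x; rewrite divr_ge0 // addr_ge0 // expR_ge0.
- by apply: avg_le => x; rewrite expR_ln_avg1.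
apply: avg_le => x; rewrite expRN expR_ln_avg1 -[leRHS]mul1r ler_pdivlMr; last first.
  by rewrite divr_gt0 // addr_gt0 // expR_gt0.
rewrite mulrC /avg1; apply: two_point => t ht.
- apply: le_trans (infconv_le _ _ f0 _ (- (2 * t))) _.
  have -> : x + w + - (2 * t) *: w = (1 - t) *: (x + w) + t *: (x - w).
    rewrite !scalerDr addrACA -scalerDl subrK scale1r -addrA scalerN -scalerBl.
    by rewrite -{1}[w]scale1r -scalerDl; congr (_ + _ *: _); ring.
  by have := fc (x + w) (x - w) t ht; rewrite !expr2; lra.
apply: le_trans (infconv_le _ _ f0 _ (2 * t)) _.
have -> : x - w + (2 * t) *: w = (1 - t) *: (x - w) + t *: (x + w).
  rewrite !scalerDr addrACA -scalerDl subrK scale1r -addrA scalerN.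
  by rewrite -{1}[w]scale1r -!scaleNr -!scalerDl; congr (_ + _ *: _); ring.
by have := fc (x - w) (x + w) t ht; rewrite !expr2; lra.
Qed.

End ConvexConcentration.

(** * Concentration of a seminorm of a random sign sum *)

Section SeminormConcentration.
Context {R : realType} {n : nat}.
Variables (q : 'rV[R]_n -> R) (hq : seminorm q) (hq2 : forall x, q x <= 2 * enorm x).
Variables (ws : seq 'rV[R]_n) (L : R) (L0 : 0 <= L).
Hypothesis hws : forall y, \sum_(w <- ws) dotv w y ^+ 2 <= L ^+ 2 * dotv y y.

(** [hws] says that the map sending y to its products with the steps has operator norm at most L;
    this is the same bound for the adjoint. *)
Lemma dotv_comb_le (s : seq R) : size s = size ws ->
  let S := \sum_(p <- zip s ws) p.1 *: p.2 in
  dotv S S <= L ^+ 2 * \sum_(a <- s) a ^+ 2.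
Proof.
move=> hs /=; set S := \sum_(p <- _) _.
have h1 : dotv S S = \sum_(p <- zip s ws) p.1 * dotv p.2 S.
  by rewrite {1}/S dotv_suml; apply: eq_bigr => p _; rewrite dotvZl.
have h2 : dotv S S ^+ 2 <= (\sum_(a <- s) a ^+ 2) * (L ^+ 2 * dotv S S).
  have h := cauchy_schwarz_seq _ (zip s ws) (fun p => p.1) (fun p => dotv p.2 S).
  rewrite {1}h1; apply: le_trans h _.
  have -> : \sum_(p <- zip s ws) p.1 ^+ 2 = \sum_(a <- s) a ^+ 2.
    by rewrite -{2}(unzip1_zip (t := ws) (s := s)) ?hs // big_map.
  have -> : \sum_(p <- zip s ws) dotv p.2 S ^+ 2 = \sum_(w <- ws) dotv w S ^+ 2.
    by rewrite -{2}(unzip2_zip (t := ws) (s := s)) ?hs // big_map.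
  by rewrite ler_wpM2l // sumr_ge0 // => a _; apply: sqr_ge0.
have [S0|S0] := eqVneq (dotv S S) 0.
  by rewrite S0 mulr_ge0 ?sqr_ge0 // sumr_ge0 // => a _; apply: sqr_ge0.
have Sp : 0 < dotv S S by rewrite lt_neqAle eq_sym S0 dotv_ge0.
by move: h2; rewrite expr2 mulrA ler_pM2r // mulrC.
Qed.

Lemma seminorm_exp_product (lam : R) : 0 <= lam ->
  avg ws (fun x => expR (lam * q x)) 0 * avg ws (fun x => expR (- (lam * q x))) 0 <=
  expR (128 * lam ^+ 2 * L ^+ 2).
Proof.
move=> lam0; set c := 128 * _ * _.
have := exp_infconv_product ws (fun x => lam * q x) (fun x => lam * q x - c) 0.
have -> : avg ws (fun x => expR (lam * q x - c)) 0 =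
    expR (- c) * avg ws (fun x => expR (lam * q x)) 0.
  by rewrite -avgM; apply: eq_avg => x; rewrite addrC expRD.
rewrite -mulrA => h; suff : expR (- c) * (avg ws (fun x => expR (lam * q x)) 0 *
    avg ws (fun x => expR (- (lam * q x))) 0) <= 1.
  by rewrite expRN ler_pdivrMl ?expR_gt0 // mulr1.
apply: h => [x|x y t /andP[t0 t1]|x s hs].
- by rewrite mulr_ge0 // seminorm_ge0.
- have h := hq.1 ((1 - t) *: x) (t *: y).
  rewrite !hq.2 (ger0_norm t0) ger0_norm ?subr_ge0 // in h.
  by have := ler_wpM2l lam0 h; lra.
set S := \sum_(p <- _) _; set r := \sum_(a <- s) a ^+ 2.
have r0 : 0 <= r by rewrite sumr_ge0 // => a _; apply: sqr_ge0.
have hS : enorm S <= L * Num.sqrt r.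
  rewrite -ler_sqr ?nnegrE ?enorm_ge0 ?mulr_ge0 ?sqrtr_ge0 //.
  by rewrite sqr_enorm exprMn sqr_sqrtr //; apply: dotv_comb_le.
have h1 : q x <= q (x + S) + 2 * (L * Num.sqrt r).
  have := seminormB hq x (x + S); have -> : x - (x + S) = - S by rewrite opprD addrA subrr add0r.
  by rewrite seminormN //; have := hq2 S; lra.
have h2 := ler_wpM2l lam0 h1.
(* Completing the square: [c] is exactly what lets the cost |s| ^ 2 / 128 absorb the Lipschitz loss
   2 lam L |s|. *)
have h3 := sqr_ge0 (128 * lam * L - Num.sqrt r).
have h4 := sqr_sqrtr r0.
have h5 : 2 * lam * L * Num.sqrt r <= c + Num.sqrt r ^+ 2 / 128.
  by move: h3; rewrite /c !expr2; lra.
by move: h5 h2; rewrite h4; lra.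
Qed.

Lemma avg_exp_ge1 (T : lmodType R) (us : seq T) (f : T -> R) v :
  avg us f v = 0 -> 1 <= avg us (fun x => expR (f x)) v.
Proof.
move=> f0; have <- : avg us (fun x => 1 + f x) v = 1 by rewrite avgD avg_cst f0 addr0.
by apply: avg_le => x; apply: expR_ge1Dx.
Qed.

Let m := avg ws q 0.

(** Centering at the mean cancels in the product of the two exponential moments. By Jensen each is
    at least 1, so each is at most the product. *)
Lemma seminorm_exp_concentration (lam : R) : 0 <= lam ->
  avg ws (fun x => expR (lam * (q x - m)) + expR (- (lam * (q x - m)))) 0 <=
  2 * expR (128 * lam ^+ 2 * L ^+ 2).
Proof.
move=> lam0; have h := seminorm_exp_product lam lam0.
have mean0 c : avg ws (fun x => c * (q x - m)) 0 = 0.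
  by rewrite avgM avgD avg_cst -/m subrr mulr0.
have h1 := avg_exp_ge1 _ ws (fun x => lam * (q x - m)) 0 (mean0 lam).
have h2 : 1 <= avg ws (fun x => expR (- (lam * (q x - m)))) 0.
  by apply: avg_exp_ge1; rewrite -(mean0 (- lam)); apply: eq_avg => x; rewrite mulNr.
have e1 : avg ws (fun x => expR (lam * (q x - m))) 0 =
    expR (- (lam * m)) * avg ws (fun x => expR (lam * q x)) 0.
  by rewrite -avgM; apply: eq_avg => x; rewrite -expRD; congr expR; ring.
have e2 : avg ws (fun x => expR (- (lam * (q x - m)))) 0 =
    expR (lam * m) * avg ws (fun x => expR (- (lam * q x))) 0.
  by rewrite -avgM; apply: eq_avg => x; rewrite -expRD; congr expR; ring.
have hprod : avg ws (fun x => expR (lam * (q x - m))) 0 *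
    avg ws (fun x => expR (- (lam * (q x - m)))) 0 <= expR (128 * lam ^+ 2 * L ^+ 2).
  rewrite e1 e2 mulrACA -expRD addNr expR0 mul1r; exact: h.
rewrite avgD; move: h1 h2 hprod; set X := avg _ _ _; set Y := avg _ _ _ => h1 h2 hprod.
have h3 := mulr_ge0 (_ : 0 <= X) (_ : 0 <= Y - 1); have {}h3 := h3 ltac:(lra) ltac:(lra).
have h4 := mulr_ge0 (_ : 0 <= Y) (_ : 0 <= X - 1); have {}h4 := h4 ltac:(lra) ltac:(lra).
by lra.
Qed.

(** The right-hand factor is the square of exp (s / 2) - exp (- s / 2), which dominates s / 2 for s
    >= 0. *)
Lemma sqr_le_exp_cosh (s : R) : s ^+ 2 <= 4 * (expR s + expR (- s) - 2).
Proof.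
wlog s0 : s / 0 <= s => [hw|].
  have [|h] := leP 0 s; first exact: hw.
  by have := hw (- s) ltac:(lra); rewrite sqrrN opprK; lra.
pose y := s / 2; have sE : s = y + y by rewrite /y; field.
have y0 : 0 <= y by rewrite /y; lra.
have h1 := expR_ge1Dx y; have h2 : expR (- y) <= 1 by rewrite -[leRHS](@expR0 R) ler_expR; lra.
have h3 := expRxMexpNx_1 y.
rewrite sE opprD !expRD expr2.
have : y * y <= (expR y - expR (- y)) * (expR y - expR (- y)) by apply: ler_pM; lra.
by move: h3; lra.
Qed.

(** Applied to the Euclidean norm, whose mean square is known exactly, it bounds the mean from
    below. *)
Lemma seminorm_variance : 0 < L ->
  avg ws (fun x => q x ^+ 2) 0 <= m ^+ 2 + 2048 * L ^+ 2.
Proof.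
(* This [lam] makes the exponent 1 / 2, and exp (1 / 2) <= 2. *)
move=> Lp; pose lam := (16 * L)^-1.
have lamL : lam * L = 1 / 16 by rewrite /lam; field; rewrite gt_eqF.
have lam0 : 0 < lam by rewrite invr_gt0 mulr_gt0.
have h := seminorm_exp_concentration lam (ltW lam0).
have e1 : 128 * lam ^+ 2 * L ^+ 2 = 1 / 2 by rewrite -mulrA -exprMn lamL expr2; field.
have h1 := expR_le_quadratic (1 / 2 : R) ltac:(lra).
have h2 : avg ws (fun x => (lam * (q x - m)) ^+ 2) 0 <= 8.
  apply: le_trans (_ : avg ws (fun x => 4 * (expR (lam * (q x - m)) +
     expR (- (lam * (q x - m)))) + - 8) 0 <= _).
    by apply: avg_le => x; have := sqr_le_exp_cosh (lam * (q x - m)); lra.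
  by rewrite avgD avg_cst avgM; move: h h1; rewrite e1 expr2; lra.
have h3 : avg ws (fun x => q x ^+ 2) 0 =
    256 * L ^+ 2 * avg ws (fun x => (lam * (q x - m)) ^+ 2) 0 + m ^+ 2.
  have lam2 : 256 * L ^+ 2 * lam ^+ 2 = 1 by rewrite -mulrA -exprMn mulrC -[L * _]mulrC lamL !expr2; field.
  transitivity (avg ws (fun x => 256 * L ^+ 2 * (lam * (q x - m)) ^+ 2 + (2 * m * q x + - m ^+ 2)) 0).
    apply: eq_avg => x; rewrite exprMn mulrA lam2 !expr2; ring.
  by rewrite !avgD !avgM avg_cst -/m !expr2; ring.
have L20 : 0 <= 256 * L ^+ 2 by rewrite mulr_ge0 ?ler0n ?sqr_ge0.
rewrite h3 addrC lerD2l; apply: le_trans (ler_wpM2l L20 h2) _.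
by rewrite mulrAC ler_wpM2r ?sqr_ge0 //; lra.
Qed.

End SeminormConcentration.

Lemma avg_sqr_enorm {R : realType} {n : nat} (ws : seq 'rV[R]_n) v :
  avg ws (fun x => enorm x ^+ 2) v = enorm v ^+ 2 + \sum_(w <- ws) enorm w ^+ 2.
Proof.
elim: ws v => [|w ws IH] v /=; first by rewrite big_nil addr0.
rewrite /avg1 !IH big_cons !sqr_enorm !dotvDl !dotvDr !dotvNl !dotvNr (dotvC w v).
by field.
Qed.

(** * The signs of the random matrix and of its products with a vector *)

Section Steps.
Context {R : realType} {n : nat}.

Definition coords (N : nat) : seq 'I_n := flatten (nseq N (enum 'I_n)).

Lemma sum_coords N (F : 'I_n -> R) : \sum_(i <- coords N) F i = N%:R * \sum_i F i.
Proof.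
rewrite /coords big_flatten; elim: N => [|N IH] /=; first by rewrite big_nil mul0r.
by rewrite big_cons IH big_enum -natr1; ring.
Qed.

Lemma size_coords N : size (coords N) = (n * N)%N.
Proof. by rewrite /coords size_flatten /shape map_nseq sumn_nseq size_enum_ord. Qed.

(** The signed steps that make up [u *m G]. They come in blocks sharing a direction [delta_mx 0 i],
    one step per row of G, so that the replacement argument can exchange whole blocks. *)
Definition steps (N : nat) (eta : R) {k} (u : 'rV[R]_k) : seq 'rV[R]_n :=
  [seq (eta * u 0 l) *: delta_mx 0 i | i <- coords N, l <- enum 'I_k].

Definition mxsteps (N : nat) (eta : R) (k : nat) : seq 'M[R]_(k, n) :=
  [seq eta *: delta_mx l i | i <- coords N, l <- enum 'I_k].

Lemma map_mxsteps N eta k (u : 'rV[R]_k) :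
  map (mulmx u) (mxsteps N eta k) = steps N eta u.
Proof.
rewrite /mxsteps /steps map_allpairs; apply: eq_allpairs => i l.
rewrite -scalemxAr -scalerA; congr (_ *: _); apply/rowP => j; rewrite !mxE.
rewrite (bigD1 l) //= big1 => [|l' hl]; first by rewrite !mxE !eqxx addr0.
by rewrite mxE (negbTE hl) mulr0.
Qed.

(** With [eta] the step size the factor is |u| ^ 2 / n whatever N is: concentration does not
    deteriorate as N grows. *)
Lemma steps_dotv N eta k (u : 'rV[R]_k) y :
  \sum_(w <- steps N eta u) dotv w y ^+ 2 = N%:R * eta ^+ 2 * enorm u ^+ 2 * dotv y y.
Proof.
rewrite /steps big_allpairs_dep sqr_enorm.
transitivity (\sum_(i <- coords N) (eta ^+ 2 * dotv u u) * y 0 i ^+ 2).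
  apply: eq_bigr => i _; rewrite big_enum /= [dotv u u]/dotv mulr_sumr mulr_suml.
  by apply: eq_bigr => l _; rewrite dotvZl dotv_delta !expr2; ring.
rewrite sum_coords -mulr_sumr.
have -> : \sum_i y 0 i ^+ 2 = dotv y y by apply: eq_bigr => i _; rewrite expr2.
by ring.
Qed.

Lemma steps_sqr_enorm N eta k (u : 'rV[R]_k) :
  \sum_(w <- steps N eta u) enorm w ^+ 2 = (n * N)%:R * eta ^+ 2 * enorm u ^+ 2.
Proof.
rewrite /steps big_allpairs_dep.
transitivity (\sum_(i <- coords N) (eta ^+ 2 * enorm u ^+ 2)).
  apply: eq_bigr => i _; rewrite big_enum /= sqr_enorm /dotv mulr_sumr.
  by apply: eq_bigr => l _; rewrite enormZ enorm_delta mulr1 real_normK ?num_real // !expr2; ring.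
by rewrite sum_coords sumr_const card_ord -mulr_natl natrM; ring.
Qed.

Lemma steps_scale N eta k (u : 'rV[R]_k) (a : R) :
  steps N eta (a *: u) = map ( *:%R a) (steps N eta u).
Proof.
rewrite /steps map_allpairs; apply: eq_allpairs => i l.
by rewrite scalerA mxE; congr (_ *: _); ring.
Qed.

Lemma avg_steps_scale (q : 'rV[R]_n -> R) N eta k (u : 'rV[R]_k) (a : R) :
  seminorm q -> avg (steps N eta (a *: u)) q 0 = `|a| * avg (steps N eta u) q 0.
Proof.
move=> hq; rewrite steps_scale -avgM.
have -> : (0 : 'rV[R]_n) = a *: 0 by rewrite scaler0.
rewrite -avg_map => [|x y|x]; rewrite ?scalerDr ?scalerN // scaler0.
by apply: eq_avg => x; rewrite hq.2.
Qed.

End Steps.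
(** * Lindeberg replacement *)

Section Smoothing.
Context {R : realType} {V : lmodType R}.
Implicit Types (f g : V -> R) (x v w : V) (s : seq V).

Definition mean s f x : R := (\sum_(v <- s) f (x + v)) / (size s)%:R.

Lemma mean_dist_le s f (c d : R) x : s != [::] ->
  (forall v, v \in s -> `|f (x + v) - d| <= c) -> `|mean s f x - d| <= c.
Proof.
move=> s0 h; have sp : 0 < (size s)%:R :> R by rewrite ltr0n lt0n size_eq0.
have -> : mean s f x - d = (\sum_(v <- s) (f (x + v) - d)) / (size s)%:R.
  rewrite big_split /= big_const_seq count_predT iter_addr addr0 mulrDl /mean.
  by rewrite -[(- d) *+ _]mulr_natr mulfK // gt_eqF.
rewrite normrM normfV [`|(size s)%:R|]gtr0_norm // ler_pdivrMr //.
apply: le_trans (ler_norm_sum _ _ _) _.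
have -> : c * (size s)%:R = \sum_(v <- s) c.
  by rewrite big_const_seq count_predT iter_addr addr0 mulr_natr.
by rewrite big_seq [leRHS]big_seq; apply: ler_sum.
Qed.

Lemma mean_lin s f g h (c : R) x :
  mean s (fun y => f y - g y - c * h y) x = mean s f x - mean s g x - c * mean s h x.
Proof. by rewrite /mean !big_split /= !sumrN -mulr_sumr; ring. Qed.

Lemma avg1_mean w s f x : avg1 w (mean s f) x = mean s (avg1 w f) x.
Proof.
rewrite /avg1 /mean -mulr_suml big_split /= -mulrDl [RHS]mulrAC; congr (_ / _ / _).
by congr (_ + _); apply: eq_bigr => v _; rewrite addrAC.
Qed.

Lemma avg1E w f x : avg1 w f x = mean [:: w; - w] f x.
Proof. by rewrite /mean !big_cons big_nil addr0. Qed.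

(** A Taylor expansion without derivatives: [D] stands for half the second derivative along [e], and
    [err] absorbs the discreteness of the smoothing. Both clauses survive averaging over
    translations, hence over all the other signs. *)
Definition smooth (C err : R) (e : V) (F : V -> R) : Prop := exists D : V -> R,
  (forall x (a : R), 0 <= a <= 1 ->
     `|avg1 (a *: e) F x - F x - a ^+ 2 * D x| <= C * a ^+ 3 + err) /\
  (forall x (a : R), 0 <= a <= 1 -> `|avg1 (a *: e) D x - D x| <= C * a).

Lemma smooth_mean C err e F s : s != [::] -> smooth C err e F -> smooth C err e (mean s F).
Proof.
move=> s0 [D [h1 h2]]; exists (mean s D); split=> x a ha.
  rewrite avg1_mean -mean_lin -[X in `|X|]subr0.
  by apply: mean_dist_le => // v _; rewrite subr0; apply: h1.
have -> : avg1 (a *: e) (mean s D) x - mean s D x =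
    mean s (fun y => avg1 (a *: e) D y - D y - 0 * D y) x.
  by rewrite mean_lin avg1_mean; ring.
rewrite -[X in `|X|]subr0; apply: mean_dist_le => // v _.
by rewrite mul0r !subr0; apply: h2.
Qed.

Lemma smooth_avg C err e F ws : smooth C err e F -> smooth C err e (avg ws F).
Proof.
move=> hF; elim: ws => [|w ws IH] //=.
have -> : avg1 w (avg ws F) = mean [:: w; - w] (avg ws F) by apply/funext => x; apply: avg1E.
exact: smooth_mean.
Qed.

Definition lip_dir e f : Prop := forall x (a : R), `|f (x + a *: e) - f x| <= 2 * `|a|.

Lemma lip_dir_mean e f s : s != [::] -> lip_dir e f -> lip_dir e (mean s f).
Proof.
move=> s0 hf x a.
have -> : mean s f (x + a *: e) - mean s f x =
    mean s (fun y => f (y + a *: e) - f y - 0 * f y) x.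
  rewrite mean_lin mul0r subr0; congr (_ - _); rewrite /mean; congr (_ / _).
  by apply: eq_bigr => v _; rewrite addrAC.
rewrite -[X in `|X|]subr0; apply: mean_dist_le => // v _.
by rewrite mul0r !subr0; apply: hf.
Qed.

Lemma lip_dir_shift e f x (a b : R) : lip_dir e f ->
  `|f (x + a *: e) - f (x + b *: e)| <= 2 * `|a - b|.
Proof. by move=> hf; have := hf (x + b *: e) (a - b); rewrite -addrA -scalerDl subrKC. Qed.

Section Grid.
Variables (e : V) (f : V -> R) (m : nat) (h : R).
Hypotheses (m0 : (0 < m)%N) (h0 : 0 < h) (hf : lip_dir e f).
Let sigma : R := m%:R * h.

Definition grid : seq V := [seq (j%:R * h) *: e | j <- iota 0 m].

Lemma grid_neq0 : grid != [::].
Proof. by rewrite -size_eq0 size_map size_iota -lt0n. Qed.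

Lemma mean_grid g x : mean grid g x = (\sum_(j < m) g (x + (j%:R * h) *: e)) / m%:R.
Proof. by rewrite /mean size_map size_iota big_map -{1}[m]subn0 -/(index_iota 0 m) big_mkord. Qed.

(* The second differences of [grid2] at small scale are averages of those of f
   at scale sigma, which makes it twice differentiable in effect. *)
Definition grid2 : V -> R := mean grid (mean grid f).

Lemma lip_dir_grid2 e' : lip_dir e' f -> lip_dir e' grid2.
Proof. by move=> ?; do 2! apply: lip_dir_mean (grid_neq0) _. Qed.

Lemma grid_dist g x : lip_dir e g -> `|mean grid g x - g x| <= 2 * sigma.
Proof.
move=> hg; apply: mean_dist_le => [|v]; first exact: grid_neq0.
case/mapP => j; rewrite mem_iota add0n => /andP[_ jm] ->.
apply: le_trans (hg _ _) _; rewrite ler_pM2l // ger0_norm ?mulr_ge0 ?(ltW h0) //.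
by rewrite /sigma ler_wpM2r ?(ltW h0) // ler_nat ltnW.
Qed.

Lemma grid2_dist x : `|grid2 x - f x| <= 4 * sigma.
Proof.
have h1 := grid_dist (mean grid f) x (lip_dir_mean _ _ _ grid_neq0 hf).
have h2 := grid_dist f x hf; have := ler_distD (mean grid f x) (grid2 x) (f x).
by rewrite /grid2; lra.
Qed.

(** Both sides complete to the sum of the first p + q terms. This trades a shift by j of a window of
    length m for a window of length j of differences at lag m, as in differentiating a moving
    average. *)
Lemma sum_shift (b : nat -> R) (p q : nat) :
  \sum_(i < p) b (i + q)%N - \sum_(i < p) b i = \sum_(i < q) b (i + p)%N - \sum_(i < q) b i.
Proof.
have h1 := @big_split_ord _ 0 +%R p q xpredT (fun i => b i).
have h2 := @big_split_ord _ 0 +%R q p xpredT (fun i => b i).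
rewrite /= in h1 h2; rewrite addnC in h2.
have : \sum_(i < p) b i + \sum_(i < q) b (p + i)%N = \sum_(i < q) b i + \sum_(i < p) b (q + i)%N.
  by rewrite -[LHS]h1 h2.
have he r t : \sum_(i < r) b (i + t)%N = \sum_(i < r) b (t + i)%N.
  by apply: eq_bigr => i _; rewrite addnC.
rewrite !he; lra.
Qed.

Let phi x := f (x + (2 * sigma) *: e) - 2 * f (x + sigma *: e) + f x.

Lemma phi_lip x (a : R) : `|phi (x + a *: e) - phi x| <= 8 * `|a|.
Proof.
have h1 := hf (x + (2 * sigma) *: e) a; have h2 := hf (x + sigma *: e) a.
have h3 := hf x a; move: h1 h2 h3; rewrite /phi !(addrAC x _ (a *: e)).
rewrite !ler_norml; lra.
Qed.

(** For a multiple a of h, shifting both windows turns the second difference exactly into a sum of j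
    ^ 2 values of [phi] over m ^ 2, at points within a of x along e; [phi_lip] then moves them to
    x. *)
Lemma grid2_second_difference (j : nat) x : let a := j%:R * h in
  `|avg1 (a *: e) grid2 x - grid2 x - a ^+ 2 * (phi x / (2 * sigma ^+ 2))| <=
  4 / sigma ^+ 2 * a ^+ 3.
Proof.
rewrite /=; set a := j%:R * h; pose y := x - a *: e; have yE : x - a *: e = y by []; clearbody y.
pose b i := f (y + (i%:R * h) *: e).
have mR : 0 < m%:R :> R by rewrite ltr0n.
have sp : 0 < sigma by rewrite mulr_gt0.
have a0 : 0 <= a by rewrite mulr_ge0 // ltW.
pose G i := \sum_(p < m) b (p + i)%N; pose H i := \sum_(p < m) G (p + i)%N.
have grid2E i : grid2 (y + (i%:R * h) *: e) = H i / m%:R ^+ 2.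
  rewrite /grid2 mean_grid expr2 invfM mulrA; congr (_ / _).
  rewrite /H mulr_suml; apply: eq_bigr => p _; rewrite mean_grid; congr (_ / _).
  apply: eq_bigr => p' _; rewrite /b; congr f.
  by rewrite -!addrA -2!scalerDl !natrD; congr (_ + _ *: _); ring.
have yx : y + a *: e = x by rewrite -yE subrK.
have e1 : avg1 (a *: e) grid2 x - grid2 x = (H (j + j)%N - 2 * H j + H 0%N) / (2 * m%:R ^+ 2).
  have := grid2E 0%N; rewrite mul0r scale0r addr0 => g0.
  have := grid2E j; rewrite -/a yx => g1.
  have := grid2E (j + j)%N; rewrite natrD mulrDl -/a scalerDl addrA yx => g2.
  by rewrite /avg1 yE g0 g1 g2; field; rewrite gt_eqF.
have phiE i : phi (y + (i%:R * h) *: e) = b (i + m + m)%N - 2 * b (i + m)%N + b i.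
  have sh t : y + (i%:R * h) *: e + t *: e = y + (i%:R * h + t) *: e by rewrite -addrA -scalerDl.
  rewrite /phi /b !sh.
  have -> : (i + m + m)%:R * h = i%:R * h + 2 * sigma by rewrite !natrD /sigma; ring.
  by have -> : (i + m)%:R * h = i%:R * h + sigma by rewrite natrD /sigma; ring.
have e2 : H (j + j)%N - 2 * H j + H 0%N =
    \sum_(p < j) \sum_(p' < j) phi (y + ((p + p')%:R * h) *: e).
  have dH i : H (i + j)%N - H i = \sum_(p < j) (G (p + m + i)%N - G (p + i)%N).
    rewrite sumrB -(sum_shift (fun p => G (p + i)%N)); congr (_ - _).
    by apply: eq_bigr => p _; congr G; lia.
  have dG i : G (i + j)%N - G i = \sum_(p < j) (b (p + m + i)%N - b (p + i)%N).
    rewrite sumrB -(sum_shift (fun p => b (p + i)%N)); congr (_ - _).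
    by apply: eq_bigr => p _; congr b; lia.
  have -> : H (j + j)%N - 2 * H j + H 0%N = (H (j + j)%N - H j) - (H (0 + j)%N - H 0%N).
    by rewrite add0n; ring.
  rewrite !dH -sumrB; apply: eq_bigr => p _; rewrite !addn0.
  transitivity ((G (p + m + j)%N - G (p + m)%N) - (G (p + j)%N - G p)); first ring.
  rewrite !dG -sumrB; apply: eq_bigr => p' _; rewrite phiE.
  have -> : (p' + m + (p + m))%N = (p + p' + m + m)%N by lia.
  have -> : (p' + (p + m))%N = (p + p' + m)%N by lia.
  have -> : (p' + m + p)%N = (p + p' + m)%N by lia.
  by rewrite (addnC p' p); ring.
have asig : a ^+ 2 / sigma ^+ 2 = j%:R ^+ 2 / m%:R ^+ 2.
  by rewrite /a /sigma; field; rewrite !gt_eqF.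
have -> : 4 / sigma ^+ 2 * a ^+ 3 = j%:R ^+ 2 * (8 * a) / (2 * m%:R ^+ 2).
  transitivity (4 * a * (a ^+ 2 / sigma ^+ 2)); first by rewrite exprS; ring.
  by rewrite asig; field; rewrite gt_eqF.
have -> : a ^+ 2 * (phi x / (2 * sigma ^+ 2)) = j%:R ^+ 2 * phi x / (2 * m%:R ^+ 2).
  transitivity (phi x / 2 * (a ^+ 2 / sigma ^+ 2)); first by field; rewrite gt_eqF.
  by rewrite asig; field; rewrite gt_eqF.
have sum2 (c : R) : j%:R ^+ 2 * c = \sum_(p < j) \sum_(p' < j) c.
  by rewrite !sumr_const card_ord -mulrnA -[c *+ _]mulr_natr natrM; ring.
rewrite e1 e2 !sum2 -mulrBl -sumrB normrM [`|_^-1|]ger0_norm; last first.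
  by rewrite invr_ge0 mulr_ge0 // sqr_ge0.
rewrite ler_wpM2r ?invr_ge0 ?mulr_ge0 ?sqr_ge0 //.
apply: le_trans (ler_norm_sum _ _ _) _; apply: ler_sum => p _.
rewrite -sumrB; apply: le_trans (ler_norm_sum _ _ _) _; apply: ler_sum => p' _.
have -> : y + ((p + p')%:R * h) *: e = x + ((p + p')%:R * h - a) *: e.
  by rewrite -yx -addrA -scalerDl subrKC.
apply: le_trans (phi_lip _ _) _; rewrite ler_pM2l // -mulrBl normrM (gtr0_norm h0).
rewrite ler_wpM2r ?(ltW h0) // natrD ler_norml.
have : (p%:R + 1 <= j%:R :> R) by rewrite natr1 ler_nat.
have : (p'%:R + 1 <= j%:R :> R) by rewrite natr1 ler_nat.
have := ler0n R p; have := ler0n R p'; lra.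
Qed.

Lemma smooth_grid2 : smooth (4 / sigma ^+ 2) (2 * h * (1 + 2 / sigma)) e grid2.
Proof.
have sp : 0 < sigma by rewrite mulr_gt0 // ltr0n.
exists (fun x => phi x / (2 * sigma ^+ 2)); split=> x a /andP[a0 a1].
  (* Rounding a down to the grid costs 2 h by the Lipschitz bound and 4 h / sigma in the quadratic
     term. *)
  pose j := Num.truncn (a / h); pose a' := j%:R * h.
  have /andP[ja aj] : j%:R <= a / h < j.+1%:R by apply: truncn_itv; rewrite divr_ge0 // ltW.
  have a'a : a' <= a by rewrite -ler_pdivlMr.
  have aa' : a - a' <= h by move: aj; rewrite ltr_pdivrMr // -natr1 /a'; lra.
  have a'0 : 0 <= a' by rewrite mulr_ge0 // ltW.
  have h1 := grid2_second_difference j x; rewrite -/a' /= in h1.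
  have h2 : `|avg1 (a *: e) grid2 x - avg1 (a' *: e) grid2 x| <= 2 * h.
    have l1 := lip_dir_shift e grid2 x a a' (lip_dir_grid2 e hf).
    have l2 := lip_dir_shift e grid2 x (- a) (- a') (lip_dir_grid2 e hf).
    have l0 : `|a - a'| = a - a' by rewrite ger0_norm ?subr_ge0.
    have l3 : `|- a - - a'| = a - a' by rewrite -opprD normrN.
    rewrite l0 in l1; rewrite l3 !scaleNr in l2.
    by move: l1 l2; rewrite /avg1 !ler_norml; lra.
  have h3 : `|phi x| <= 4 * sigma.
    have l1 := lip_dir_shift e f x (2 * sigma) sigma hf.
    have l2 := hf x sigma.
    have l3 : 2 * sigma - sigma = sigma by ring.
    rewrite (gtr0_norm sp) in l2; rewrite l3 (gtr0_norm sp) in l1.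
    by move: l1 l2; rewrite /phi !ler_norml; lra.
  have h4 : `|a' ^+ 2 * (phi x / (2 * sigma ^+ 2)) - a ^+ 2 * (phi x / (2 * sigma ^+ 2))| <=
      4 * h / sigma.
    rewrite -mulrBl normrM distrC subr_sqr !normrM normfV (ger0_norm (_ : 0 <= a - a')) ?subr_ge0 //.
    rewrite (ger0_norm (_ : 0 <= a + a')) ?addr_ge0 // (ger0_norm (_ : 0 <= 2 * sigma ^+ 2)); last first.
      by rewrite mulr_ge0 // sqr_ge0.
    have -> : 4 * h / sigma = h * 2 * (4 * sigma / (2 * sigma ^+ 2)) by field; rewrite gt_eqF.
    have s2 : 0 <= (2 * sigma ^+ 2)^-1 by rewrite invr_ge0 mulr_ge0 // sqr_ge0.
    apply: ler_pM; last by rewrite ler_wpM2r.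
    - by rewrite mulr_ge0 ?subr_ge0 ?addr_ge0.
    - by rewrite mulr_ge0.
    by apply: ler_pM; rewrite ?subr_ge0 ?addr_ge0 //; lra.
  have h5 : 4 / sigma ^+ 2 * a' ^+ 3 <= 4 / sigma ^+ 2 * a ^+ 3.
    by rewrite ler_wpM2l ?divr_ge0 ?sqr_ge0 // lerXn2r.
  have -> : 2 * h * (1 + 2 / sigma) = 2 * h + 4 * h / sigma by ring.
  move: h1 h2 h4 h5; move: (a ^+ 2 * _) (a' ^+ 2 * _) (4 / _ * _) (4 / _ * _) (4 * h / _).
  move=> X1 X2 X3 X4 X5; rewrite !ler_norml; lra.
have h1 := phi_lip x a; have h2 := phi_lip x (- a).
rewrite (ger0_norm a0) in h1; rewrite normrN (ger0_norm a0) scaleNr in h2.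
have -> : avg1 (a *: e) (fun x => phi x / (2 * sigma ^+ 2)) x - phi x / (2 * sigma ^+ 2) =
  ((phi (x + a *: e) - phi x) / 2 + (phi (x - a *: e) - phi x) / 2) / (2 * sigma ^+ 2).
  by rewrite /avg1; field; rewrite gt_eqF.
rewrite normrM normfV (ger0_norm (_ : 0 <= 2 * sigma ^+ 2)); last by rewrite mulr_ge0 ?sqr_ge0.
have -> : 4 / sigma ^+ 2 * a = 8 * a / (2 * sigma ^+ 2) by field; rewrite gt_eqF.
apply: ler_wpM2r; first by rewrite invr_ge0 mulr_ge0 // sqr_ge0.
by move: h1 h2; rewrite !ler_norml; lra.
Qed.

End Grid.
End Smoothing.

(** * Exchanging blocks of signs of equal variance *)

Section Lindeberg.
Context {R : realType} {V : lmodType R}.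

Lemma avg1_normr (w : V) (a : R) f : avg1 (a *: w) f = avg1 (`|a| *: w) f.
Proof.
have [a0|a0] := leP 0 a; first by rewrite ger0_norm.
by apply/funext => x; rewrite ltr0_norm // scaleNr /avg1 opprK addrC.
Qed.

(** Each step adds its own a ^ 2 D, and D hardly changes under the other steps, so only the total
    variance counts. The constant 2 C collects the Taylor error and the drift of D. *)
Lemma avg_block (C err eta : R) (e : V) (F D : V -> R) (us : seq R) x :
  0 <= C -> 0 <= eta <= 1 ->
  (forall x (a : R), 0 <= a <= 1 ->
     `|avg1 (a *: e) F x - F x - a ^+ 2 * D x| <= C * a ^+ 3 + err) ->
  (forall x (a : R), 0 <= a <= 1 -> `|avg1 (a *: e) D x - D x| <= C * a) ->
  \sum_(u <- us) u ^+ 2 <= 1 ->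
  `|avg [seq (eta * u) *: e | u <- us] F x - F x - eta ^+ 2 * (\sum_(u <- us) u ^+ 2) * D x|
    <= (size us)%:R * (2 * C * eta ^+ 3 + err).
Proof.
move=> C0 /andP[eta0 eta1] hF hD; elim: us x => [|u us IH] x.
  by move=> _; rewrite /= big_nil mulr0 mul0r !subr0 subrr normr0 mul0r.
rewrite big_cons /=; set s := \sum_(u <- us) u ^+ 2 in IH * => hs.
have s0 : 0 <= s by rewrite sumr_ge0 // => v _; apply: sqr_ge0.
have u0 := sqr_ge0 u.
have s1 : s <= 1 by lra.
have u1 : `|u| <= 1 by rewrite -[leRHS]normr1 -ler_sqr ?nnegrE // !real_normK ?num_real //; lra.
rewrite avg1_normr normrM (ger0_norm eta0); set a := eta * `|u|.
have a0 : 0 <= a by rewrite mulr_ge0.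
have aeta : a <= eta by rewrite ler_piMr.
have a1 : 0 <= a <= 1 by lra.
have a2 : a ^+ 2 = eta ^+ 2 * u ^+ 2 by rewrite exprMn real_normK ?num_real.
have a3 : C * a ^+ 3 <= C * eta ^+ 3 by rewrite ler_wpM2l // lerXn2r.
set c := eta ^+ 2 * s; have c0 : 0 <= c by rewrite mulr_ge0 // sqr_ge0.
have cC : c * (C * a) <= C * eta ^+ 3.
  have : c * (C * a) <= eta ^+ 2 * (C * eta).
    by apply: ler_pM; rewrite ?mulr_ge0 ?ler_wpM2l // ler_piMr ?sqr_ge0.
  by rewrite !exprS expr0; lra.
have h1 := avg_dist [:: a *: e] (avg [seq (eta * u) *: e | u <- us] F)
  (fun y => F y + c * D y) ((size us)%:R * (2 * C * eta ^+ 3 + err)) x.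
have {}h1 := h1 (fun y => ltac:(rewrite opprD addrA; exact: IH y s1)).
have e1 : avg [:: a *: e] (fun y => F y + c * D y) x = avg1 (a *: e) F x + c * avg1 (a *: e) D x.
  by rewrite avgD avgM.
rewrite e1 /= in h1.
have h2 := hF x a a1.
have h3 : `|c * (avg1 (a *: e) D x - D x)| <= C * eta ^+ 3.
  rewrite normrM (ger0_norm c0); apply: le_trans cC; rewrite ler_wpM2l //; exact: hD.
have -> : (size us).+1%:R = (size us)%:R + 1 :> R by rewrite natr1.
have -> : eta ^+ 2 * (u ^+ 2 + s) = a ^+ 2 + c by rewrite a2 /c; ring.
move: h1 h2 h3 a3; move: (C * a ^+ 3) (avg1 _ _ _) (avg1 _ _ _) (avg1 _ _ _) => B A1 A2 A3.
rewrite !ler_norml; lra.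
Qed.

(** Lindeberg's telescope: while one block is exchanged, those after it are averaged into F, and
    those before it only contract the difference. *)
Lemma avg_flatten_dist (I : Type) (r : seq I) (b1 b2 : I -> seq V) (F : V -> R) (K : R) x :
  (forall i ws x, `|avg (b1 i) (avg ws F) x - avg (b2 i) (avg ws F) x| <= K) ->
  `|avg (flatten (map b1 r)) F x - avg (flatten (map b2 r)) F x| <= (size r)%:R * K.
Proof.
move=> h; elim: r x => [|i r IH] x; first by rewrite /= subrr normr0 mul0r.
rewrite /= !avg_cat -natr1 mulrDl mul1r.
apply: le_trans (ler_distD (avg (b1 i) (avg (flatten (map b2 r)) F) x) _ _) _.
by apply: lerD => //; apply: avg_dist => y; apply: IH.
Qed.

End Lindeberg.

(** Normalized so that u G has mean square |u| ^ 2. *)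
Definition step_size {R : realType} (n N : nat) : R := (Num.sqrt (n * N)%:R)^-1.

Lemma sqr_step_size {R : realType} (n N : nat) : (0 < n * N)%N -> (n * N)%:R * step_size n N ^+ 2 = 1 :> R.
Proof. by move=> h; rewrite exprVn sqr_sqrtr ?ler0n // mulfV // pnatr_eq0 -lt0n. Qed.

Section NormInvariance.
Context {R : realType} {n : nat}.
Variables (q : 'rV[R]_n -> R) (hq : seminorm q) (hq2 : forall x, q x <= 2 * enorm x).

Lemma seminorm_lip_dir i : lip_dir (delta_mx 0 i) q.
Proof.
move=> x a; have h1 := seminormB hq (x + a *: delta_mx 0 i) x.
have h2 := seminormB hq x (x + a *: delta_mx 0 i).
rewrite opprD addrA subrr add0r seminormN // in h2; rewrite addrAC subrr add0r in h1.
have := hq2 (a *: delta_mx 0 i); rewrite enormZ enorm_delta mulr1.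
by rewrite ler_norml; lra.
Qed.

(** The coordinate directions are smoothed in turn; later averages keep earlier smoothness. The
    factor n is harmless because sigma may depend on n. *)
Lemma smooth_approx (m : nat) (h : R) : (0 < m)%N -> 0 < h ->
  let sigma := m%:R * h in
  exists F : 'rV[R]_n -> R, (forall x, `|F x - q x| <= n%:R * (4 * sigma)) /\
    forall i, smooth (4 / sigma ^+ 2) (2 * h * (1 + 2 / sigma)) (delta_mx 0 i) F.
Proof.
move=> m0 h0 sigma.
pose F (s : seq 'I_n) := foldr (fun i g => grid2 (delta_mx 0 i) g m h) q s.
have lipF s i : lip_dir (delta_mx 0 i) (F s).
  elim: s => [|j s IH] /=; first exact: seminorm_lip_dir.
  exact: lip_dir_grid2.
exists (F (enum 'I_n)); split=> [x|i].
  rewrite -[n in n%:R]size_enum_ord; elim: (enum 'I_n) => [|j s IH].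
    by rewrite /= subrr normr0 mul0r.
  rewrite /= -natr1 mulrDl mul1r [leRHS]addrC.
  apply: le_trans (ler_distD (F s x) _ _) _; apply: lerD => //.
  exact: grid2_dist.
have : i \in enum 'I_n by rewrite mem_enum.
elim: (enum 'I_n) => [|j s IH] //=; rewrite inE => /orP[/eqP ->|/IH hs].
  exact: smooth_grid2.
by rewrite /grid2; do 2! apply: smooth_mean (grid_neq0 _ _ _ m0) _.
Qed.

(* Both walks have the same variance per coordinate, and a smoothed q sees a
   block of steps only through its variance, up to O(step_size ^ 3); there are
   n N = step_size ^ (-2) blocks. *)
Lemma avg_steps_unit (k : nat) (t : R) : (0 < n)%N -> 0 < t ->
  exists N0 : nat, forall N (u : 'rV[R]_k), (N0 < N)%N -> enorm u = 1 ->
    `|avg (steps N (step_size n N) u) q 0 -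
      avg (steps N (step_size n N) (const_mx 1 : 'rV[R]_1)) q 0| <= t.
Proof.
move=> n0 t0; have nR : 0 < n%:R :> R by rewrite ltr0n.
(* Each of the two smoothing errors n * 4 sigma takes t / 4, leaving t / 2 for the exchanges. *)
pose sigma := t / (16 * n%:R); have sp : 0 < sigma by rewrite divr_gt0 // mulr_gt0.
pose C := 4 / sigma ^+ 2; have C0 : 0 <= C by rewrite divr_ge0 // sqr_ge0.
have k1 : 0 < k.+1%:R :> R by rewrite ltr0n.
pose X := t / (2 * k.+1%:R * (2 * C + 1)).
have Xp : 0 < X by rewrite divr_gt0 // !mulr_gt0 //; lra.
(* N > X ^ (-2) makes the step size at most X, which keeps all exchanges together below t / 2. *)
exists (Num.truncn (X ^- 2)) => N u hN hu.
have N0 : (0 < N)%N by apply: leq_ltn_trans hN.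
have nN0 : (0 < n * N)%N by rewrite muln_gt0 n0.
pose eta : R := step_size n N; have eta2 := @sqr_step_size R n N nN0; rewrite -/eta in eta2 *.
have etap : 0 < eta by rewrite invr_gt0 sqrtr_gt0 ltr0n.
have eta1 : eta <= 1.
  rewrite invf_le1 ?sqrtr_gt0 ?ltr0n // -[leLHS]sqrtr1 ler_sqrt ?ler0n //.
  by rewrite ler1n.
have etaX : eta <= X.
  rewrite -[X]invrK lef_pV2 ?posrE ?sqrtr_gt0 ?ltr0n ?invr_gt0 //.
  rewrite -[X^-1]ger0_norm ?invr_ge0 ?(ltW Xp) // -sqrtr_sqr ler_sqrt ?ler0n // exprVn.
  apply: le_trans (_ : N%:R <= _); last by rewrite ler_nat leq_pmull.
  by apply: le_trans (ltW (truncnS_gt _)) _; rewrite ler_nat.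
(* The mesh is chosen after N, so that rounding costs at most eta ^ 3 per step. *)
have [m m0 hm] : exists2 m : nat, (0 < m)%N & 2 * (sigma / m%:R) * (1 + 2 / sigma) <= eta ^+ 3.
  pose Y := 2 * sigma * (1 + 2 / sigma) / eta ^+ 3.
  exists (Num.truncn Y).+1 => //.
  have : Y < (Num.truncn Y).+1%:R by apply: truncnS_gt.
  rewrite ltr_pdivrMr ?exprn_gt0 // mulrC -ltr_pdivrMl // => /ltW h.
  by apply: le_trans h; rewrite le_eqVlt; apply/orP; left; apply/eqP; ring.
have mR : 0 < m%:R :> R by rewrite ltr0n.
have [F [hF1 hF2]] := smooth_approx m (sigma / m%:R) m0 (divr_gt0 sp mR).
have sE : m%:R * (sigma / m%:R) = sigma by rewrite mulrC divfK // gt_eqF.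
rewrite sE in hF1 hF2.
have hF3 x : `|F x - q x| <= t / 4.
  by apply: le_trans (hF1 x) _; rewrite /sigma le_eqVlt; apply/orP; left; apply/eqP; field; rewrite gt_eqF.
pose err := 2 * (sigma / m%:R) * (1 + 2 / sigma); rewrite -/err in hm hF2.
pose K := 2 * C * eta ^+ 3 + err.
pose blk k' (v : 'rV[R]_k') (i : 'I_n) : seq 'rV[R]_n :=
  [seq (eta * v 0 l) *: delta_mx 0 i | l <- enum 'I_k'].
have hblk i ws x : `|avg (blk k u i) (avg ws F) x -
    avg (blk 1%N (const_mx 1) i) (avg ws F) x| <= k.+1%:R * K.
  have [D [h1 h2]] := smooth_avg _ _ _ _ ws (hF2 i).
  have hb k' (v : 'rV[R]_k') : enorm v = 1 ->
      `|avg (blk k' v i) (avg ws F) x - avg ws F x - eta ^+ 2 * D x| <= k'%:R * K.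
    move=> hv.
    have hs : \sum_(w <- [seq v 0 l | l <- enum 'I_k']) w ^+ 2 = 1.
      rewrite big_map big_enum /= -(expr1n R 2) -hv sqr_enorm.
      by apply: eq_bigr => l _; rewrite expr2.
    have := avg_block C err eta (delta_mx 0 i) (avg ws F) D [seq v 0 l | l <- enum 'I_k'] x C0 _ h1 h2 _.
    rewrite hs mulr1 size_map size_enum_ord -map_comp => h; apply: h => //.
    by rewrite ltW.
  have b1 := hb k u hu.
  have := hb 1%N (const_mx 1); rewrite mul1r => b2.
  have {}b2 := b2 ltac:(by rewrite /enorm /dotv big_ord1 !mxE mulr1 sqrtr1).
  rewrite -natr1 mulrDl mul1r.
  move: b1 b2; move: (avg _ _ _) (avg _ _ _) (k%:R * K) (eta ^+ 2 * _) => A1 A2 A3 A4.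
  rewrite !ler_norml; lra.
have hd := avg_flatten_dist _ (coords N) (blk k u) (blk 1%N (const_mx 1)) F _ 0 hblk.
rewrite size_coords in hd.
have htot : (n * N)%:R * (k.+1%:R * K) <= t / 2.
  have hK : K <= (2 * C + 1) * eta * eta ^+ 2.
    by rewrite /K; move: hm; rewrite !exprS expr0; lra.
  have h1 : (n * N)%:R * (k.+1%:R * K) <= k.+1%:R * (2 * C + 1) * eta.
    apply: le_trans (_ : (n * N)%:R * (k.+1%:R * ((2 * C + 1) * eta * eta ^+ 2)) <= _).
      by rewrite ler_wpM2l ?ler0n // ler_wpM2l ?ler0n.
    have -> : (n * N)%:R * (k.+1%:R * ((2 * C + 1) * eta * eta ^+ 2)) =
      k.+1%:R * (2 * C + 1) * eta * ((n * N)%:R * eta ^+ 2) by ring.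
    by rewrite eta2 mulr1.
  apply: le_trans h1 _; apply: le_trans (_ : k.+1%:R * (2 * C + 1) * X <= _).
    by rewrite ler_wpM2l // mulr_ge0 ?ler0n //; lra.
  rewrite /X le_eqVlt; apply/orP; left; apply/eqP; field.
  by rewrite !gt_eqF //; lra.
have hu1 := avg_dist (steps N eta u) F q _ 0 hF3.
have hu2 := avg_dist (steps N eta (const_mx 1 : 'rV[R]_1)) F q _ 0 hF3.
have st k' (v : 'rV[R]_k') : steps N eta v = flatten (map (blk k' v) (coords N)) by [].
rewrite -!st in hd.
move: hu1 hu2 hd htot; move: (avg _ _ _) (avg _ _ _) (avg _ _ _) (avg _ _ _) (_%:R * _) => A1 A2 A3 A4 A5.
rewrite !ler_norml; lra.
Qed.

End NormInvariance.
(** * Almost Euclidean subspaces *)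

Section Net.
Context {R : realType}.

(** Counting by exponential weights: the indicator of |z|_1 <= k M is at most 2 ^ (k M) times the
    product of the 2 ^ (- |z_l|), and the sum over z factors into k geometric series, each at most 4
    with its signs. *)
Lemma card_lattice_net (k B M : nat) (P : pred {ffun 'I_k -> bool * 'I_B.+1}) :
  (forall f, P f -> (\sum_l (f l).2 <= k * M)%N) -> #|P|%:R <= (2 ^+ ((M + 2) * k) : R).
Proof.
move=> hP.
have h1 : #|P|%:R <= \sum_(f : {ffun 'I_k -> bool * 'I_B.+1})
    (2 ^+ (k * M) * \prod_l (2^-1 ^+ (f l).2 : R)).
  rewrite -sum1_card natr_sum big_mkcond /=; apply: ler_sum => f _.
  have h0 : 0 <= 2 ^+ (k * M) * \prod_l (2^-1 ^+ (f l).2 : R).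
    by rewrite mulr_ge0 ?exprn_ge0 // prodr_ge0 // => l _; rewrite exprn_ge0.
  case: ifP => // /hP hf; rewrite prodrXr /= exprVn ler_pdivlMr ?exprn_gt0 // mul1r.
  by rewrite ler_eXn2l // ltr1n.
apply: le_trans h1 _; rewrite -mulr_sumr.
rewrite -(bigA_distr_bigA (fun l (p : bool * 'I_B.+1) => 2^-1 ^+ p.2 : R)) /=.
have h2 (m : nat) : \sum_(j < m.+1) (2^-1 ^+ j : R) = 2 - 2^-1 ^+ m.
  elim: m => [|m IH]; first by rewrite big_ord1 !expr0; ring.
  by rewrite big_ord_recr /= IH exprS; field.
have h3 : \sum_(p : bool * 'I_B.+1) (2^-1 ^+ p.2 : R) <= 4.
  rewrite -(pair_bigA _ (fun (b : bool) (j : 'I_B.+1) => 2^-1 ^+ j : R)) /=.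
  rewrite big_bool /= h2; have : 0 <= (2^-1 ^+ B : R) by rewrite exprn_ge0.
  lra.
rewrite prodr_const card_ord mulnDl exprD mulnC ler_wpM2l ?exprn_ge0 //.
rewrite exprM; have -> : 2 ^+ 2 = 4 :> R by rewrite expr2; ring.
by rewrite lerXn2r ?nnegrE // sumr_ge0 // => p _; rewrite exprn_ge0.
Qed.

(** A lattice of mesh 1 / (M sqrt k). Rounding coordinates toward 0 stays in the ball and moves a
    point by at most 1 / M; Cauchy-Schwarz bounds the l1 norm of the integer coordinates by k M. *)
Lemma ball_net (k M : nat) : (0 < k)%N -> (0 < M)%N -> exists r : seq 'rV[R]_k,
  [/\ (size r)%:R <= (2 ^+ ((M + 2) * k) : R), forall v, v \in r -> enorm v <= 1
    & forall u, enorm u <= 1 -> exists2 v, v \in r & enorm (u - v) <= M%:R^-1].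
Proof.
move=> k0 M0; pose B := (M * k)%N; pose s : R := Num.sqrt k%:R.
have kR : 0 < k%:R :> R by rewrite ltr0n.
have MR : 0 < M%:R :> R by rewrite ltr0n.
have sp : 0 < s by rewrite sqrtr_gt0.
have s2 : s ^+ 2 = k%:R by rewrite sqr_sqrtr // ltW.
have Ms : 0 < M%:R * s by rewrite mulr_gt0.
pose vec (f : {ffun 'I_k -> bool * 'I_B.+1}) : 'rV[R]_k :=
  \row_l ((-1) ^+ (f l).1 * ((f l).2%:R / (M%:R * s))).
pose P : pred {ffun 'I_k -> bool * 'I_B.+1} := [pred f | enorm (vec f) <= 1].
exists [seq vec f | f <- enum P]; split.
- rewrite size_map -cardE; apply: card_lattice_net => f /= hf.
  rewrite -(ler_nat R) natr_sum natrM.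
  have hsq : \sum_l ((f l).2%:R : R) ^+ 2 = (M%:R * s) ^+ 2 * enorm (vec f) ^+ 2.
    rewrite sqr_enorm /dotv mulr_sumr; apply: eq_bigr => l _; rewrite !mxE.
    rewrite -[X in _ * X]expr2 [((-1) ^+ _ * _) ^+ 2]exprMn sqrr_sign mul1r expr_div_n mulrC divfK //.
    by rewrite expf_neq0 // gt_eqF.
  have /= := cauchy_schwarz_seq _ (index_enum 'I_k) (fun l => (f l).2%:R : R) (fun=> 1).
  have -> : \sum_(i : 'I_k) (1 : R) ^+ 2 = k%:R.
    by under eq_bigr do rewrite expr1n; rewrite sumr_const card_ord.
  under [X in X ^+ 2 <= _]eq_bigr do rewrite mulr1.
  rewrite hsq exprMn s2 => h.
  rewrite -ler_sqr ?nnegrE ?mulr_ge0 ?ler0n ?sumr_ge0 //.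
  apply: le_trans h _; rewrite exprMn.
  have : enorm (vec f) ^+ 2 <= 1 by rewrite expr_le1 ?enorm_ge0.
  have : 0 <= M%:R ^+ 2 * k%:R * k%:R :> R by rewrite !mulr_ge0 ?ler0n ?sqr_ge0.
  by rewrite !expr2; nra.
- by move=> v /mapP[f]; rewrite mem_enum => hf ->.
move=> u hu.
have hul l : `|u 0 l| <= 1 by apply: le_trans (ler_norm_enorm u l) hu.
pose z l := Num.truncn (`|u 0 l| * (M%:R * s)).
have hz l : (z l)%:R <= `|u 0 l| * (M%:R * s) < (z l).+1%:R.
  by apply: truncn_itv; rewrite mulr_ge0 // ltW.
have zB l : (z l < B.+1)%N.
  rewrite ltnS -(ler_nat R); have /andP[h _] := hz l; apply: le_trans h _.
  rewrite natrM; apply: le_trans (_ : 1 * (M%:R * s) <= _).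
    by rewrite ler_wpM2r // ltW.
  rewrite mul1r ler_wpM2l ?ler0n // -s2 expr2 ler_peMr ?(ltW sp) //.
  by rewrite -sqrtr1 ler_sqrt ?ler0n // ler1n.
pose f : {ffun 'I_k -> bool * 'I_B.+1} := [ffun l => (u 0 l < 0, Ordinal (zB l))].
have vE l : vec f 0 l = (-1) ^+ (u 0 l < 0)%R * ((z l)%:R / (M%:R * s)) by rewrite mxE ffunE.
have uE l : u 0 l = (-1) ^+ (u 0 l < 0)%R * `|u 0 l|.
  exact: numEsign.
have le1 l : (z l)%:R / (M%:R * s) <= `|u 0 l|.
  by rewrite ler_pdivrMr //; have /andP[] := hz l.
have le2 l : `|u 0 l| - (z l)%:R / (M%:R * s) <= (M%:R * s)^-1.
  rewrite lerBlDl -[X in _ + X]mul1r -mulrDl natr1 ler_pdivlMr //.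
  by have /andP[_ /ltW] := hz l.
exists (vec f).
  apply: map_f; rewrite mem_enum inE /=; apply: le_trans hu.
  rewrite -ler_sqr ?nnegrE ?enorm_ge0 // !sqr_enorm; apply: ler_sum => l _.
  have -> : vec f 0 l * vec f 0 l = ((z l)%:R / (M%:R * s)) ^+ 2.
    by rewrite vE -expr2 exprMn sqrr_sign mul1r.
  have -> : u 0 l * u 0 l = `|u 0 l| ^+ 2 by rewrite real_normK ?num_real // expr2.
  rewrite lerXn2r ?nnegrE //.
  by rewrite divr_ge0 ?ler0n // ltW.
rewrite -ler_sqr ?nnegrE ?enorm_ge0 ?invr_ge0 ?ler0n // sqr_enorm.
apply: le_trans (_ : \sum_(l < k) ((M%:R * s)^-1 ^+ 2) <= _).
  apply: ler_sum => l _.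
  have -> : (u - vec f) 0 l = (-1) ^+ (u 0 l < 0)%R * (`|u 0 l| - (z l)%:R / (M%:R * s)).
    by rewrite mxE [X in _ + X]mxE vE mulrBr -uE.
  rewrite -expr2 exprMn sqrr_sign mul1r.
  by rewrite lerXn2r ?nnegrE ?invr_ge0 ?subr_ge0 // ltW.
rewrite sumr_const card_ord -[_ *+ k]mulr_natr exprVn exprMn s2.
by rewrite le_eqVlt; apply/orP; left; apply/eqP; field; rewrite !gt_eqF.
Qed.

Lemma seminorm_bounded (k : nat) (p : 'rV[R]_k -> R) : seminorm p ->
  exists B, forall u, enorm u <= 1 -> p u <= B.
Proof.
move=> hp; exists (\sum_l p (delta_mx 0 l)) => u hu.
rewrite [u in p u]row_sum_delta.
apply: le_trans (_ : \sum_l p (u 0 l *: delta_mx 0 l) <= _).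
  elim/big_ind2 : _ => [|x y a b h1 h2|l _] //; first by rewrite seminorm0.
  by apply: le_trans (hp.1 _ _) _; apply: lerD.
apply: ler_sum => l _; rewrite hp.2 ler_piMl ?seminorm_ge0 //.
by apply: le_trans (ler_norm_enorm u l) hu.
Qed.

(** Net points may be shorter than 1, hence the comparison with [enorm v * m]. One approximation
    step gives Q <= m + 2 t + t Q for the supremum Q over the ball, so Q <= m + 8 t, and Q in turn
    controls the error from below. *)
Lemma net_to_sphere (k M : nat) (p : 'rV[R]_k -> R) (r : seq 'rV[R]_k) (m : R) :
  let t := M%:R^-1 in
  (1 < M)%N -> seminorm p -> 0 <= m <= 2 -> (forall v, v \in r -> enorm v <= 1) ->
  (forall u, enorm u <= 1 -> exists2 v, v \in r & enorm (u - v) <= t) ->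
  (forall v, v \in r -> `|p v - enorm v * m| <= 2 * t) ->
  forall u, enorm u = 1 -> `|p u - m| <= 10 * t.
Proof.
move=> t M1 hp /andP[m0 m2] hr1 hr2 hr3.
have t0 : 0 < t by rewrite invr_gt0 ltr0n ltnW.
have M2 : 2 <= M%:R :> R by rewrite ler_nat.
have t1 : t <= 1 / 2.
  by rewrite div1r /t lef_pV2 // posrE; lra.
clearbody t.
have [B hB] := seminorm_bounded k p hp.
pose Q := sup [set p u | u in [set u | enorm u <= 1]].
have hQ u : enorm u <= 1 -> p u <= Q.
  by move=> hu; apply: ub_le_sup; [exists B => _ [v hv <-]; apply: hB|exists u].
have Q0 : 0 <= Q by apply: le_trans (hQ 0 _); rewrite ?seminorm_ge0 ?enorm0.
have hQt u : enorm u <= t -> p u <= t * Q.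
  move=> hu; have -> : u = t *: (t^-1 *: u) by rewrite scalerA mulfV ?gt_eqF // scale1r.
  rewrite hp.2 gtr0_norm // ler_pM2l //; apply: hQ.
  by rewrite enormZ gtr0_norm ?invr_gt0 // ler_pdivrMl // mulr1.
have hup u : enorm u <= 1 -> p u <= m + 2 * t + t * Q.
  move=> hu; have [v hv huv] := hr2 u hu.
  have h1 := seminormB hp u v; have h2 := hQt _ huv.
  have h3 := hr3 v hv; have h4 := hr1 v hv; have h5 := ler_piMl m0 h4.
  by move: h3; rewrite ler_norml; lra.
have Q1 : Q <= m + 2 * t + t * Q.
  apply: sup_le_ub => [|_ [u hu <-]]; last exact: hup.
  by exists (p 0); exists 0; rewrite //= enorm0.
have Q2 : Q <= m + 8 * t by nra.
move=> u hu; have hu1 : enorm u <= 1 by rewrite hu.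
have h0 := hQ u hu1.
have [v hv huv] := hr2 u hu1.
have h1 := seminormB hp v u; have h2 := hQt _ huv.
rewrite -(seminormN hp (v - u)) opprB in h1.
have h3 := hr3 v hv.
have h4 : 1 - t <= enorm v.
  have := seminormB seminorm_enorm u v; rewrite hu; lra.
have h5 := ler_wpM2r m0 h4.
have h6 : t * Q <= t * (m + 8 * t) by rewrite ler_wpM2l // ltW.
have h7 : t * m <= t * 2 by rewrite ler_wpM2l // ltW.
have h8 : t * t <= t * (1 / 2) by rewrite ler_wpM2l // ltW.
by move: h3; rewrite !ler_norml; lra.
Qed.

End Net.

(** * Random matrices and the Dvoretzky-Milman theorem *)

Section Embedding.
Context {R : realType}.

Lemma steps_exp_concentration (n N k : nat) (q : 'rV[R]_n -> R) (v : 'rV[R]_k) (lam : R) :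
  (0 < n)%N -> (0 < N)%N -> seminorm q -> (forall x, q x <= 2 * enorm x) ->
  enorm v <= 1 -> 0 <= lam ->
  let ws := steps N (step_size n N) v in
  avg ws (fun x => expR (lam * (q x - avg ws q 0)) + expR (- (lam * (q x - avg ws q 0)))) 0 <=
  2 * expR (128 * lam ^+ 2 / n%:R).
Proof.
move=> n0 N0 hq hq2 hv lam0 /=; have nR : 0 < n%:R :> R by rewrite ltr0n.
have L2 : (Num.sqrt n%:R)^-1 ^+ 2 = n%:R^-1 :> R by rewrite exprVn sqr_sqrtr // ltW.
rewrite -L2; apply: seminorm_exp_concentration => // y.
rewrite steps_dotv ler_wpM2r ?dotv_ge0 // L2.
have := @sqr_step_size R n N; rewrite muln_gt0 n0 N0 natrM => /(_ isT) h.
have -> : N%:R * step_size n N ^+ 2 = n%:R^-1 :> R.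
  by apply: (mulfI (lt0r_neq0 nR)); rewrite mulrA h mulfV // gt_eqF.
by rewrite ler_piMr ?invr_ge0 ?ler0n // expr_le1 ?enorm_ge0.
Qed.

(** Union bound: [Phi] adds the exponentials of all deviations, so a matrix where it is below exp
    (lam t) has no large one. The factor 4 counts two seminorms and two tails. *)
Lemma random_matrix (n N k : nat) (r : seq 'rV[R]_k) (p : bool -> 'rV[R]_n -> R) (t lam : R) :
  (0 < n)%N -> (0 < N)%N -> (forall b, seminorm (p b)) -> (forall b x, p b x <= 2 * enorm x) ->
  (forall v, v \in r -> enorm v <= 1) -> 0 < lam ->
  4 * (size r)%:R * expR (128 * lam ^+ 2 / n%:R) < expR (lam * t) ->
  exists G : 'M[R]_(k, n), forall b v, v \in r ->
    `|p b (v *m G) - avg (steps N (step_size n N) v) (p b) 0| <= t.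
Proof.
move=> n0 N0 hp hp2 hr lam0 hlt.
pose E b (v : 'rV[R]_k) := avg (steps N (step_size n N) v) (p b) 0.
pose T b (v : 'rV[R]_k) (x : 'rV[R]_n) := expR (lam * (p b x - E b v)) + expR (- (lam * (p b x - E b v))).
pose Phi (G : 'M[R]_(k, n)) := \sum_(b : bool) \sum_(v <- r) T b v (v *m G).
have [|G hG] := avg_lt_exists (mxsteps N (step_size n N) k) Phi (expR (lam * t)) 0.
  apply: le_lt_trans hlt; rewrite avg_sum.
  apply: le_trans (_ : \sum_(b : bool) \sum_(v <- r) 2 * expR (128 * lam ^+ 2 / n%:R) <= _).
    apply: ler_sum => b _; rewrite avg_sum big_seq [leRHS]big_seq; apply: ler_sum => v hv.
    rewrite (avg_map (mulmx v)) => [|x y|x]; rewrite ?mulmxDr ?mulmxN // mulmx0 map_mxsteps.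
    by apply: steps_exp_concentration => //; [apply: hr|apply: ltW].
  rewrite big_bool /= big_const_seq count_predT iter_addr addr0 -mulr_natr.
  by rewrite le_eqVlt; apply/orP; left; apply/eqP; ring.
exists G => b v hv; rewrite -/(E b v) leNgt; apply/negP => hd.
have T0 b' v' x : 0 <= T b' v' x by rewrite addr_ge0 // expR_ge0.
have h1 : T b v (v *m G) <= Phi G.
  rewrite /Phi (bigD1 b) //= (big_rem v hv) /= -addrA lerDl addr_ge0 ?sumr_ge0 // => b' _.
  by rewrite sumr_ge0.
have h2 : expR (lam * t) <= T b v (v *m G).
  rewrite /T; move: hd; set d := p b _ - _; have [d0|d0] := leP 0 d => hd.
    rewrite ger0_norm // in hd.
    apply: le_trans (_ : expR (lam * d) <= _); first by rewrite ler_expR ler_pM2l // ltW.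
    by rewrite lerDl expR_ge0.
  rewrite ltr0_norm // in hd.
  apply: le_trans (_ : expR (- (lam * d)) <= _); first by rewrite -mulrN ler_expR ler_pM2l // ltW.
  by rewrite lerDr expR_ge0.
by have := lt_le_trans hG (le_trans h2 h1); rewrite ltxx.
Qed.

Lemma expR1_ge2 : 2 <= expR 1 :> R.
Proof. by have := expR_ge1Dx (1 : R); lra. Qed.

Lemma unit_direction (k : nat) (v : 'rV[R]_k) : (0 < k)%N ->
  exists2 u, enorm u = 1 & v = enorm v *: u.
Proof.
move=> k0; have [->|v0] := eqVneq v 0.
  by exists (delta_mx 0 (Ordinal k0)); rewrite ?enorm_delta // enorm0 scale0r.
have vp := enorm_gt0 v v0; exists ((enorm v)^-1 *: v).
  by rewrite enormZ ger0_norm ?invr_ge0 ?enorm_ge0 // mulVf // gt_eqF.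
by rewrite scalerA mulfV ?scale1r // gt_eqF.
Qed.

(** The lower bounds 1 / 2 turn additive errors into relative ones; the one for q comes from |x| <=
    q x. *)
Lemma almost_isometric_matrix (n k M : nat) (q : 'rV[R]_n -> R) :
  let t := M%:R^-1 in
  (0 < k)%N -> (1 < M)%N -> seminorm q -> (forall x, enorm x <= q x <= 2 * enorm x) ->
  (M + 4)%:R * k%:R <= t ^+ 2 * n%:R / 1024 ->
  exists (G : 'M[R]_(k, n)) (a b : R), [/\ 1 / 2 <= a, 1 / 2 <= b &
    forall u, enorm u = 1 -> `|enorm (u *m G) - a| <= 10 * t /\ `|q (u *m G) - b| <= 10 * t].
Proof.
rewrite /=; set t := M%:R^-1; move=> k0 M1 hq hq12 hkn.
have t0 : 0 < t by rewrite invr_gt0 ltr0n ltnW.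
have t1 : t <= 1 by rewrite invf_le1 ?ler1n ?ltr0n ltnW.
have k1 : 1 <= k%:R :> R by rewrite ler1n.
have M4 : 4 <= (M + 4)%:R :> R by rewrite natrD lerDr ler0n.
(* Since k >= 1, the dimension hypothesis already forces n to be large. *)
have nbig : 4096 <= n%:R :> R.
  have h1 : 4 * 1 <= (M + 4)%:R * k%:R :> R by apply: ler_pM.
  have h2 : t ^+ 2 * n%:R <= n%:R by rewrite ler_piMl ?ler0n // expr_le1 // ltW.
  by lra.
have nR : 0 < n%:R :> R by lra.
have n0 : (0 < n)%N by rewrite -(ltr0n R).
pose p (b : bool) : 'rV[R]_n -> R := if b then q else enorm.
have hp b : seminorm (p b) by case: b => //; apply: seminorm_enorm.
have hp2 b x : p b x <= 2 * enorm x.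
  by case: b; [have /andP[] := hq12 x|rewrite /=; have := enorm_ge0 x; lra].
have [Nq hNq] := avg_steps_unit _ (hp true) (hp2 true) k t n0 t0.
have [Ne hNe] := avg_steps_unit _ (hp false) (hp2 false) k t n0 t0.
pose N := (maxn Nq Ne).+1; have N0 : (0 < N)%N by [].
pose u1 : 'rV[R]_1 := const_mx 1.
have u1E : enorm u1 = 1 by rewrite /enorm /dotv big_ord1 !mxE mulr1 sqrtr1.
pose m b := avg (steps N (step_size n N) u1) (p b) 0.
have hm b (u : 'rV[R]_k) : enorm u = 1 -> `|avg (steps N (step_size n N) u) (p b) 0 - m b| <= t.
  by case: b => hu; [apply: hNq|apply: hNe]; rewrite // /N ltnS ?leq_maxl ?leq_maxr.
have hm' b (v : 'rV[R]_k) : enorm v <= 1 ->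
    `|avg (steps N (step_size n N) v) (p b) 0 - enorm v * m b| <= t.
  move=> hv; have [u hu vE] := unit_direction k v k0.
  rewrite {1}vE avg_steps_scale // [`|enorm v|]ger0_norm ?enorm_ge0 // -mulrBr normrM.
  rewrite [`|enorm v|]ger0_norm ?enorm_ge0 // -[leRHS]mul1r.
  by apply: ler_pM; rewrite ?enorm_ge0 // hm.
have me2 : avg (steps N (step_size n N) u1) (fun x : 'rV[R]_n => enorm x ^+ 2) 0 = 1.
  rewrite avg_sqr_enorm enorm0 expr0n add0r steps_sqr_enorm u1E expr1n mulr1.
  by rewrite sqr_step_size // muln_gt0 n0.
have me_le1 : m false <= 1.
  have : m false <= avg (steps N (step_size n N) u1) (fun x : 'rV[R]_n => 2^-1 * (1 + enorm x ^+ 2)) 0.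
    by apply: avg_le => x; have := sqr_ge0 (enorm x - 1); rewrite /p /= !expr2; lra.
  by rewrite avgM avgD avg_cst me2; lra.
(* The mean square is 1 and the variance at most 2048 / n <= 1 / 2. *)
have me_ge : 1 / 2 <= m false.
  have L0 : 0 < (Num.sqrt n%:R)^-1 :> R by rewrite invr_gt0 sqrtr_gt0.
  have L2 : (Num.sqrt n%:R)^-1 ^+ 2 = n%:R^-1 :> R by rewrite exprVn sqr_sqrtr // ltW.
  have := seminorm_variance _ (hp false) (hp2 false) (steps N (step_size n N) u1) _ (ltW L0) _ L0.
  rewrite /= me2 L2 => h.
  have {}h : 1 <= m false ^+ 2 + 2048 * n%:R^-1.
    apply: h => y; rewrite steps_dotv u1E expr1n mulr1 ler_wpM2r ?dotv_ge0 //.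
    have := @sqr_step_size R n N; rewrite muln_gt0 n0 N0 natrM => /(_ isT) h.
    have -> // : N%:R * step_size n N ^+ 2 = n%:R^-1 :> R.
    by apply: (mulfI (lt0r_neq0 nR)); rewrite mulrA h mulfV // gt_eqF.
  have h2 : 2048 * n%:R^-1 <= 1 / 2 :> R.
    rewrite ler_pdivrMr //; apply: le_trans (_ : 1 / 2 * 4096 <= _); first lra.
    by rewrite ler_pM2l ?divr_gt0 ?ltr0n.
  have m0 : 0 <= m false.
    by rewrite -(avg_cst (steps N (step_size n N) u1 : seq 'rV[R]_n) 0 0); apply: avg_le => x; apply: enorm_ge0.
  rewrite leNgt; apply/negP => hlt.
  have : m false ^+ 2 < (1 / 2) ^+ 2 by rewrite ltrXn2r.
  by rewrite [(1 / 2) ^+ 2]expr2; lra.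
have mq_ge : m false <= m true by apply: avg_le => x; have /andP[] := hq12 x.
have mq_le : m true <= 2 * m false by rewrite -avgM; apply: avg_le => x; apply: (hp2 true).
have [r [hr1 hr2 hr3]] := @ball_net R k M k0 (ltnW M1).
(* The minimizer of 128 lam ^ 2 / n - lam t; the minimum - t ^ 2 n / 512 beats the exponent (M + 4)
   k of the union bound. *)
pose lam := t * n%:R / 256.
have lam0 : 0 < lam by rewrite divr_gt0 ?mulr_gt0 ?ltr0n.
have [|G hG] := random_matrix n N k r p t lam n0 N0 hp hp2 hr2 lam0.
  apply: le_lt_trans (_ : expR ((M + 4)%:R * k%:R) * expR (128 * lam ^+ 2 / n%:R) < _).
    rewrite ler_pM2r ?expR_gt0 //.
    apply: le_trans (_ : 2 ^+ (2 + (M + 2) * k) <= _).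
      by rewrite exprD; have -> : 2 ^+ 2 = 4 :> R by [rewrite expr2; ring]; rewrite ler_pM2l.
    apply: le_trans (_ : 2 ^+ ((M + 4) * k) <= _).
      rewrite ler_eXn2l ?ltr1n //.
      have -> : ((M + 4) * k = 2 * k + (M + 2) * k)%N.
        by rewrite -mulnDl; congr (_ * _)%N; rewrite addnC -[4%N]/(2 + 2)%N -addnA (addnC 2%N M).
      by rewrite leq_add2r leq_pmulr.
    rewrite -natrM -[((M + 4) * k)%:R]mulr1 expRM_natl lerXn2r ?nnegrE ?expR_ge0 //.
    exact: expR1_ge2.
  rewrite -expRD ltr_expR.
  have -> : 128 * lam ^+ 2 / n%:R = t ^+ 2 * n%:R / 512.
    by rewrite /lam; field; rewrite gt_eqF.
  have -> : lam * t = t ^+ 2 * n%:R / 256 by rewrite /lam; ring.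
  have : 4 * 1 <= (M + 4)%:R * k%:R :> R by apply: ler_pM.
  by lra.
have hG2 b v : v \in r -> `|p b (v *m G) - enorm v * m b| <= 2 * t.
  move=> hv; have h1 := hG b v hv; have h2 := hm' b v (hr2 v hv).
  by move: h1 h2; rewrite !ler_norml; lra.
have hsph b : 0 <= m b <= 2 -> forall u, enorm u = 1 -> `|p b (u *m G) - m b| <= 10 * t.
  move=> hb; apply: (net_to_sphere k M (fun u => p b (u *m G)) r (m b) M1 _ hb hr2 hr3 (hG2 b)).
  split=> [x y|a x]; first by rewrite mulmxDl (hp b).1.
  by rewrite -scalemxAl (hp b).2.
exists G, (m false), (m true); split=> [//||u hu]; first by lra.
by split; [apply: (hsph false)|apply: (hsph true)] => //; lra.
Qed.

Lemma dvoretzky (delta : R) : 0 < delta <= 1 -> exists2 c : R, 0 < c &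
  forall (n : nat) (q : 'rV[R]_n -> R), (0 < n)%N -> seminorm q ->
    (forall x, enorm x <= q x <= 2 * enorm x) ->
    exists (E : {vspace 'rV[R]_n}) (rho : R),
      [/\ c * n%:R <= (\dim E)%:R, (0 < \dim E)%N, 0 < rho &
        forall x, x \in E ->
          (1 - delta) * rho * enorm x <= q x <= (1 + delta) * rho * enorm x].
Proof.
move=> /andP[d0 d1].
(* This makes 10 t <= delta / 20, a relative error of at most delta / 10 since a, b >= 1 / 2. *)
pose M := (Num.truncn (200 / delta)).+2; pose t : R := M%:R^-1.
have MR : 0 < M%:R :> R by rewrite ltr0n.
have td : t <= delta / 200.
  rewrite -[delta / 200]invf_div lef_pV2 ?posrE ?divr_gt0 //.
  by apply: le_trans (ltW (truncnS_gt _)) _; rewrite ler_nat.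
have t0 : 0 < t by rewrite invr_gt0.
have M1 : (1 < M)%N by [].
clearbody M; pose c0 := t ^+ 2 / (1024 * (M + 4)%:R).
have M4 : 0 < (M + 4)%:R :> R by rewrite ltr0n addn4.
have c00 : 0 < c0 by rewrite divr_gt0 ?exprn_gt0 ?mulr_gt0 ?ltr0n ?addn4.
(* Halving c0 absorbs the rounding: for k >= 1, k >= (k + 1) / 2 > c0 n / 2. *)
exists (c0 / 2) => [|n q n0 hq hq12]; first by rewrite divr_gt0.
have nR : 0 < n%:R :> R by rewrite ltr0n.
pose k := Num.truncn (c0 * n%:R).
have /andP[kle kgt] : k%:R <= c0 * n%:R < k.+1%:R by apply: truncn_itv; rewrite mulr_ge0 // ltW.
(* If k = 0 then c0 n < 1 and a line is large enough; on it q is a multiple of the Euclidean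
   norm. *)
have [k0|k0] := posnP k.
  pose v : 'rV[R]_n := delta_mx 0 (Ordinal n0); have v1 : enorm v = 1 by rewrite enorm_delta.
  have v0 : v != 0.
    by apply/eqP => h; have := v1; rewrite h enorm0 => /esym/eqP; rewrite oner_eq0.
  exists <[v]>%VS, (q v); rewrite dim_vline v0; split => //.
  - have {}kgt : c0 * n%:R < 1 by move: kgt; rewrite k0.
    apply: (@le_trans _ _ 1) => //; rewrite mulrAC.
    by move: kgt; move: (c0 * _) => z; lra.
  - by have := hq12 v; rewrite v1; lra.
  move=> x /vlineP[a ->]; rewrite hq.2 enormZ v1.
  have : 0 <= delta * (`|a| * q v) by rewrite !mulr_ge0 ?(ltW d0) ?normr_ge0 ?(seminorm_ge0 hq).
  by clear; move: (q v) `|a| => z y; lra.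
have k1 : 1 <= k%:R :> R by rewrite ler1n.
have [|G [a [b [a0 b0 hG]]]] := almost_isometric_matrix n k M q k0 M1 hq hq12.
  have h1024 : 0 < 1024 * (M + 4)%:R :> R by rewrite mulr_gt0 ?M4 ?ltr0n.
  move: kle; rewrite /c0 mulrAC ler_pdivlMr // -/t => h.
  rewrite ler_pdivlMr ?ltr0n //; apply: le_trans h.
  by rewrite le_eqVlt; apply/orP; left; apply/eqP; move: (k%:R) (_%:R) => x y; ring.
rewrite -/t in hG; clearbody k c0 t.
have hlow (u : 'rV[R]_k) : u != 0 -> 0 < enorm (u *m G).
  move=> u0; have [w w1 ->] := unit_direction k u k0.
  rewrite -scalemxAl enormZ ger0_norm ?enorm_ge0 // mulr_gt0 ?(enorm_gt0 u u0) //.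
  by have [+ _] := hG w w1; rewrite ler_norml; lra.
pose f := linfun (mulmxr G : 'rV[R]_k -> 'rV[R]_n).
have fE u : f u = u *m G by rewrite lfunE.
have dimE : \dim (f @: fullv) = k.
  transitivity (\dim (fullv : {vspace 'rV[R]_k})); last by rewrite dimvf /dim /= mul1n.
  apply: limg_dim_eq; apply/eqP; rewrite -subv0; apply/subvP => u.
  rewrite memv_cap memv_ker fE memv0 => /andP[_ /eqP hu].
  by apply: contraT => /hlow; rewrite hu enorm0 ltxx.
exists (f @: fullv)%VS, (b / a); rewrite dimE; split=> //.
- by move: kgt; rewrite -natr1; lra.
- by rewrite divr_gt0 //; lra.
move=> x /memv_imgP[u _ ->]; rewrite fE.
have [w w1 ->] := unit_direction k u k0.
rewrite -scalemxAl enormZ hq.2 (ger0_norm (enorm_ge0 u)).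
have [hA hB] := hG w w1; have U0 := enorm_ge0 u.
have ap : 0 < a by apply: lt_le_trans a0; rewrite divr_gt0.
pose r := enorm (w *m G) / a.
have rE : b / a * enorm (w *m G) = b * r by rewrite /r; ring.
have {hA}hr : 1 - delta / 10 <= r <= 1 + delta / 10.
  move: hA; rewrite ler_norml ler_pdivlMr // ler_pdivrMr // => /andP[h1 h2].
  have h3 : 10 * t <= delta / 10 * a.
    have : delta / 10 * (1 / 2) <= delta / 10 * a by rewrite ler_wpM2l // divr_ge0 // ltW.
    by move: td; clear; lra.
  by move: h1 h2 h3; clear; lra.
have {}hB : b * (1 - delta / 10) <= q (w *m G) <= b * (1 + delta / 10).
  move: hB; rewrite ler_norml => /andP[h1 h2].
  have h3 : 10 * t <= delta / 10 * b.
    have : delta / 10 * (1 / 2) <= delta / 10 * b by rewrite ler_wpM2l // divr_ge0 // ltW.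
    by move: td; clear; lra.
  by move: h1 h2 h3; clear; lra.
have b1 : 0 <= b by apply: le_trans b0; rewrite divr_ge0.
suff hkey : (1 - delta) * (b * r) <= q (w *m G) <= (1 + delta) * (b * r).
  move/andP: hkey => [h1 h2].
  have {}h1 := ler_wpM2l U0 h1; have {}h2 := ler_wpM2l U0 h2.
  by rewrite -rE in h1 h2; move: h1 h2; clear; move: (b / a) => rho; lra.
have dd : 0 <= delta * delta by rewrite mulr_ge0 // ltW.
have bdd : 0 <= b * (delta * delta) by rewrite mulr_ge0.
have bd : 0 <= b * delta by rewrite mulr_ge0 // ltW.
move/andP: hr => [r1 r2].
have h1 : (1 - delta) * (b * r) <= (1 - delta) * (b * (1 + delta / 10)).
  by rewrite ler_wpM2l ?subr_ge0 // ler_wpM2l.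
have h2 : (1 + delta) * (b * (1 - delta / 10)) <= (1 + delta) * (b * r).
  by rewrite ler_wpM2l ?addr_ge0 ?ler01 ?(ltW d0) // ler_wpM2l.
have bd1 : b * (delta * delta) <= b * delta by rewrite ler_wpM2l // ler_piMl // ltW.
by move: hB h1 h2 bdd bd bd1; clear; lra.
Qed.

End Embedding.
(** * Projections of flowers *)

Section OrthogonalProjection.
Context {R : realType} {n : nat}.

(** Normal equations: for B with a basis of E as rows, the Gram matrix is invertible, as u B B^T = 0
    forces |u B| = 0. *)
Lemma orth_proj_exists (E : {vspace 'rV[R]_n}) (x : 'rV[R]_n) : exists p, is_orth_proj E x p.
Proof.
pose d := \dim E; pose b := vbasis E.
pose B : 'M[R]_(d, n) := \matrix_(i < d) b`_i.
have mulB (u : 'rV[R]_d) : u *m B = \sum_i u 0 i *: b`_i.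
  by rewrite mulmx_sum_row; apply: eq_bigr => i _; rewrite rowK.
have BE (u : 'rV[R]_d) : u *m B \in E.
  rewrite mulB; apply: memv_suml => i _; apply: memvZ.
  by apply: vbasis_mem; rewrite mem_nth // size_tuple.
have dotE (y z : 'rV[R]_n) : dotv y z = (y *m z^T) 0 0.
  by rewrite mxE; apply: eq_bigr => i _; rewrite mxE.
have unitB : B *m B^T \in unitmx.
  rewrite -row_free_unit; apply: inj_row_free => u hu.
  have h0 : u *m B = 0.
    apply: enorm_eq0; rewrite /enorm dotE trmx_mul -mulmxA (mulmxA B) (mulmxA u) hu.
    by rewrite mul0mx mxE sqrtr0.
  apply/rowP => i; rewrite mxE.
  have /freeP : free b by apply: basis_free (vbasisP E).
  by apply; rewrite -mulB.
pose v := x *m B^T *m invmx (B *m B^T).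
exists (v *m B); split => // e eE.
have -> : e = (\row_i coord b i e) *m B.
  by rewrite {1}(coord_vbasis eE) mulB; apply: eq_bigr => i _; rewrite mxE.
rewrite dotE trmx_mul mulmxA mulmxBl -(mulmxA v) /v mulmxKV // subrr mul0mx.
by rewrite mxE.
Qed.

End OrthogonalProjection.

(** * The support function of a flower and its projections *)

Section FlowerGauge.
Context {R : realType} {n : nat}.
Variables (A F : set 'rV[R]_n) (B : R).
Hypotheses (A0 : A !=set0) (AB : forall x, A x -> enorm x <= B).

(** Twice the support function of the petals of x and - x together: that of the ball B_x at th is
    (<x, th> + |x| |th|) / 2. *)
Definition petal_width (th x : 'rV[R]_n) : R := `|dotv x th| + enorm x * enorm th.

Definition flower_gauge (th : 'rV[R]_n) : R := sup [set petal_width th x | x in A].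

Lemma flower_gauge_has_sup th : has_sup [set petal_width th x | x in A].
Proof.
split; first by have [x Ax] := A0; exists (petal_width th x); exists x.
exists (2 * (B * enorm th)) => _ [x Ax <-]; rewrite /petal_width.
have := ler_dotv x th; have := ler_wpM2r (enorm_ge0 th) (AB x Ax); lra.
Qed.

Lemma flower_gauge_ge th x : A x -> petal_width th x <= flower_gauge th.
Proof. by move=> Ax; apply: ub_le_sup; [have [] := flower_gauge_has_sup th|exists x]. Qed.

Lemma flower_gauge_le th c : (forall x, A x -> petal_width th x <= c) -> flower_gauge th <= c.
Proof.
move=> h; apply: sup_le_ub => [|_ [x Ax <-]]; last exact: h.
by have [] := flower_gauge_has_sup th.
Qed.

Lemma flower_gauge_adherent th d : 0 < d -> exists2 x, A x & flower_gauge th - d < petal_width th x.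
Proof.
move=> d0; have [_ [x Ax <-] h] := sup_adherent d0 (flower_gauge_has_sup th).
by exists x.
Qed.

Lemma petal_width_seminorm x : seminorm (petal_width ^~ x).
Proof.
split=> [y z|a y]; rewrite /petal_width.
  have := ler_wpM2l (enorm_ge0 x) (ler_enormD y z).
  by rewrite dotvDr; have := ler_normD (dotv x y) (dotv x z); lra.
by rewrite dotvZr normrM enormZ; ring.
Qed.

Lemma flower_gauge_seminorm : seminorm flower_gauge.
Proof.
have hD y z : flower_gauge (y + z) <= flower_gauge y + flower_gauge z.
  apply: flower_gauge_le => x Ax; apply: le_trans ((petal_width_seminorm x).1 y z) _.
  by apply: lerD; apply: flower_gauge_ge.
have hZ a y : flower_gauge (a *: y) <= `|a| * flower_gauge y.
  apply: flower_gauge_le => x Ax; rewrite (petal_width_seminorm x).2.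
  by rewrite ler_wpM2l // flower_gauge_ge.
split=> // a y; apply/eqP; rewrite eq_le hZ /=.
have [->|a0] := eqVneq a 0.
  rewrite normr0 mul0r; have [x Ax] := A0; apply: le_trans (flower_gauge_ge _ x Ax).
  by rewrite addr_ge0 // mulr_ge0 // enorm_ge0.
have := hZ a^-1 (a *: y); rewrite scalerA mulVf // scale1r normfV.
by rewrite mulrC ler_pdivlMr ?normr_gt0 // mulrC.
Qed.

Lemma flower_gauge_bounds th : let r := sup [set enorm x | x in A] in
  r * enorm th <= flower_gauge th <= 2 * (r * enorm th).
Proof.
rewrite /=; set r := sup _.
have hr : has_sup [set enorm x | x in A].
  split; first by have [x Ax] := A0; exists (enorm x); exists x.
  by exists B => _ [x Ax <-]; apply: AB.
have r_ge x : A x -> enorm x <= r by move=> Ax; apply: ub_le_sup; [have [] := hr|exists x].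
apply/andP; split; last first.
  apply: flower_gauge_le => x Ax; rewrite /petal_width.
  have := ler_dotv x th; have := ler_wpM2r (enorm_ge0 th) (r_ge x Ax); lra.
have [->|th0] := eqVneq th 0.
  by rewrite enorm0 mulr0 (seminorm_ge0 flower_gauge_seminorm).
rewrite -ler_pdivlMr ?enorm_gt0 //; apply: sup_le_ub => [|_ [x Ax <-]].
  by have [] := hr.
rewrite ler_pdivlMr ?enorm_gt0 //; apply: le_trans (flower_gauge_ge th x Ax).
by rewrite lerDr.
Qed.

Hypothesis AF : F = \bigcup_(x in A) petal x.
Hypothesis FN : F = [set - x | x in F].

Lemma petal_opp (x y : 'rV[R]_n) : petal (- x) y -> petal x (- y).
Proof. by rewrite /petal /= enormN scalerN opprK -enormN opprD. Qed.

Lemma petal_subset x (sg : bool) : A x -> petal ((-1) ^+ sg *: x) `<=` F.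
Proof.
move=> Ax; have hx : petal x `<=` F by move=> y hy; rewrite AF; exists x.
case: sg => /=; last by rewrite expr0 scale1r.
rewrite expr1 scaleN1r => y /petal_opp /hx hy; rewrite FN.
by exists (- y); rewrite ?opprK.
Qed.

Variables (E : {vspace 'rV[R]_n}) (W d : R).
Hypotheses (W0 : 0 < W) (d0 : 0 < d <= 1 / 17).
Hypothesis flower_gaugeE : forall x, x \in E ->
  (1 - d) * W * enorm x <= flower_gauge x <= (1 + d) * W * enorm x.

(** If y projects to p then |p| ^ 2 = <y, p>, at most the support function of F at p, which is half
    the gauge. *)
Lemma orth_proj_image_le p : orth_proj_image E F p -> enorm p <= (1 + d) * W / 2.
Proof.
move=> [y]; rewrite AF => -[x Ax hy] [pE hp].
have [->|p0] := eqVneq p 0.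
  by rewrite enorm0 divr_ge0 // mulr_ge0 ?(ltW W0) // addr_ge0 // ltW; case/andP: d0.
have pp := enorm_gt0 p p0.
have h1 : enorm p ^+ 2 = dotv (y - 2^-1 *: x) p + 2^-1 * dotv x p.
  rewrite sqr_enorm; have := hp p pE; rewrite !dotvDl !dotvNl dotvZl; lra.
have h2 := le_trans (ler_norm _) (ler_dotv (y - 2^-1 *: x) p).
have h3 := ler_wpM2r (enorm_ge0 p) hy.
have h4 := ler_norm (dotv x p).
have h5 := flower_gauge_ge p x Ax; rewrite /petal_width in h5.
have /andP[_ h6] := flower_gaugeE p pE.
have : enorm p * enorm p <= (1 + d) * W / 2 * enorm p by rewrite -expr2; lra.
by rewrite ler_pM2r.
Qed.

(* Let x nearly realize the gauge at th, p be its projection, X = |x|, P = |p|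
   and a = <x, th>. Then P + X <= (1 + d) W and a + X >= (1 - 2 d) W, so p is
   nearly parallel to th and s th lies in the projection of the petal of x. *)
Lemma ball_sub_orth_proj_image th s : th \in E -> enorm th = 1 ->
  0 <= s <= W * (1 / 2 - 4 * d) -> orth_proj_image E F (s *: th).
Proof.
move=> thE th1 /andP[s0 sr].
move/andP: (flower_gaugeE th thE); rewrite th1 !mulr1 => -[g1 g2].
have dW : 0 < d * W by rewrite mulr_gt0 //; case/andP: d0.
have [x0 Ax0 hx0] := flower_gauge_adherent th (d * W) dW.
(* Symmetry of F allows the sign of x0 to be flipped so that <x, th> >= 0. *)
pose sg := dotv x0 th < 0; pose x := (-1) ^+ sg *: x0.
have widthE y : petal_width y x = petal_width y x0.
  by rewrite /petal_width dotvZl normrM enormZ normrX normrN1 expr1n !mul1r.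
have [p [pE hp]] := orth_proj_exists E x.
pose a := dotv x th; pose P := enorm p; pose X := enorm x.
have aE : petal_width th x0 = a + X.
  rewrite -widthE /petal_width th1 mulr1; congr (_ + _); rewrite ger0_norm //.
  rewrite dotvZl /sg; have [h|h] := ltP (dotv x0 th) 0; last by rewrite expr0 mul1r.
  by rewrite expr1 mulN1r oppr_ge0 ltW.
have dotp e : e \in E -> dotv x e = dotv p e.
  by move=> /hp; rewrite dotvDl dotvNl => /eqP; rewrite subr_eq0 => /eqP.
have aP : a <= P.
  by rewrite /a dotp //; apply: le_trans (ler_norm _) _; rewrite -[P]mulr1 -th1 ler_dotv.
have h1 : W * (1 - 2 * d) <= a + X by rewrite -aE; move: hx0 g1; lra.
(* The gauge is used at p itself rather than at th: <x, p> = P ^ 2, so the width of x there is P (P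
   + X). *)
have h2 : P + X <= (1 + d) * W.
  have [p0|p0] := eqVneq p 0.
    rewrite /P p0 enorm0 add0r; apply: le_trans g2; apply: le_trans (flower_gauge_ge th x0 Ax0).
    by rewrite -widthE /petal_width th1 mulr1 lerDr.
  have pp := enorm_gt0 p p0; have /andP[_ h] := flower_gaugeE p pE.
  have h' := flower_gauge_ge p x0 Ax0; rewrite -widthE /petal_width in h'.
  rewrite dotp // -sqr_enorm ger0_norm ?sqr_ge0 // in h'.
  rewrite -(ler_pM2r pp); apply: le_trans (le_trans h' h).
  by rewrite le_eqVlt; apply/orP; left; apply/eqP; rewrite /P /X; ring.
have PX : P <= X.
  have [p0|p0] := eqVneq p 0; first by rewrite /P p0 enorm0 enorm_ge0.
  have pp := enorm_gt0 p p0; rewrite -(ler_pM2r pp) -/P -expr2 sqr_enorm -dotp //.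
  by apply: le_trans (ler_norm _) _; apply: ler_dotv.
(* This is |s th - p / 2| <= X / 2, squared and expanded. If s > a, then s <= (X + P) / 2 and s - a
   <= (X - P) / 2. *)
have key : s * (s - a) <= (X - P) * (X + P) / 4.
  have XP0 : 0 <= (X - P) * (X + P) / 4.
    by rewrite divr_ge0 // mulr_ge0 ?subr_ge0 ?addr_ge0 ?enorm_ge0.
  have [sa|sa] := leP s a.
    by apply: le_trans XP0; rewrite mulr_ge0_le0 // subr_le0.
  have -> : (X - P) * (X + P) / 4 = (X + P) / 2 * ((X - P) / 2) by field.
  apply: ler_pM => //; first by rewrite subr_ge0 ltW.
  - by move: sr h1 aP dW; lra.
  by move: sr h1 h2 aP dW; lra.
(* Half of x - p is orthogonal to E: adding it keeps the projection at s th and matches the center x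
   / 2 off E. *)
exists (s *: th + 2^-1 *: (x - p)); last first.
  split; first by rewrite memvZ.
  by move=> e eE; rewrite addrAC subrr add0r dotvZl hp // mulr0.
apply: (petal_subset x0 sg Ax0); rewrite /petal /= -/x -/X.
have -> : s *: th + 2^-1 *: (x - p) - 2^-1 *: x = s *: th - 2^-1 *: p.
  by rewrite scalerBr -addrA (addrAC (2^-1 *: x)) subrr add0r.
rewrite -ler_sqr ?nnegrE ?divr_ge0 ?enorm_ge0 // sqr_enorm.
rewrite dotvDl !dotvDr !dotvNl !dotvNr !dotvZl !dotvZr (dotvC p th) -!sqr_enorm th1 -/P.
have -> : dotv th p = a by rewrite dotvC -dotp.
by move: key; rewrite !expr2; lra.
Qed.

Lemma flower_geom_dist (eps : R) : (0 < \dim E)%N -> (1 + d) <= (1 + eps) * (1 - 8 * d) ->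
  (geom_dist (orth_proj_image E F) (eball E) <= (1 + eps)%:E)%E.
Proof.
move=> dimE heps; have /andP[dp d1] := d0.
pose a := (1 + d) * W / 2; pose r := W * (1 / 2 - 4 * d).
have a0 : 0 < a by rewrite divr_gt0 // mulr_gt0 //; lra.
have r0 : 0 < r by rewrite mulr_gt0 //; lra.
apply: (@le_trans _ _ (a * r^-1)%:E); last first.
  by rewrite lee_fin ler_pdivrMr // /a /r; have := ler_wpM2r (ltW W0) heps; lra.
apply: ereal_inf_lbound; exists a, r^-1; split => //; first by rewrite invr_gt0.
- move=> _ [p hp <-]; split => /=.
    rewrite enormZ ger0_norm ?invr_ge0 ?(ltW a0) // ler_pdivrMl // mulr1.
    exact: orth_proj_image_le.
  by apply: memvZ; case: hp => y _ [].
move=> z [/= z1 zE].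
(* The point z = 0 has no direction of its own and borrows one from E, hence the positive
   dimension. *)
have [th thE [th1 zth]] : exists2 th, th \in E & enorm th = 1 /\ z = enorm z *: th.
  have dir v : v != 0 -> v \in E -> exists2 th, th \in E & enorm th = 1 /\ v = enorm v *: th.
    move=> v0 vE; have vp := enorm_gt0 v v0.
    exists ((enorm v)^-1 *: v); first by rewrite memvZ.
    split; first by rewrite enormZ ger0_norm ?invr_ge0 ?enorm_ge0 // mulVf // gt_eqF.
    by rewrite scalerA mulfV ?scale1r // gt_eqF.
  have [->|z0] := eqVneq z 0; last exact: dir.
  have [|th thE [th1 _]] := dir (vpick E) _ (memv_pick E).
    by rewrite vpick0; apply: contraTneq dimE => ->; rewrite dimv0.
  by exists th => //; rewrite enorm0 scale0r.
exists (r *: z); last by rewrite scalerA mulVf ?scale1r // gt_eqF.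
rewrite zth scalerA; apply: ball_sub_orth_proj_image => //.
by rewrite mulr_ge0 ?enorm_ge0 ?(ltW r0) //= ler_piMr // ltW.
Qed.

End FlowerGauge.

Lemma flower_points {R : realType} {n : nat} (A F : set 'rV[R]_n) : (0 < n)%N ->
  F = \bigcup_(x in A) petal x -> compact F -> interior F 0 ->
  (exists B, forall x, A x -> enorm x <= B) /\ exists2 x, A x & 0 < enorm x.
Proof.
move=> n0 AF Fc F0; split.
  have [M [_ hM]] := compact_bounded Fc.
  pose K := M + 1; exists (Num.sqrt (\sum_(i < n) K ^+ 2)) => x Ax.
  (* A point x lies on the boundary of its own petal, so A is contained in F and inherits its
     bound. *)
  have Fx : F x.
    rewrite AF; exists x => //; rewrite /petal /=.
    have -> : x - 2^-1 *: x = 2^-1 *: x by rewrite -{1}[x]scale1r -scalerBl; congr (_ *: _); lra.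
    by rewrite enormZ ger0_norm ?invr_ge0 // mulrC.
  have hx : `|x| <= K by apply: hM => //; rewrite ltrDl.
  rewrite ler_wsqrtr //; apply: ler_sum => i _.
  have xi : `|x 0 i| <= K.
    apply: le_trans hx; rewrite -[`|x|]/(mx_norm x) mx_normrE.
    exact: (le_bigmax _ (fun ij : 'I_1 * 'I_n => `|x ij.1 ij.2|) (0, i)).
  rewrite -expr2 -[x 0 i ^+ 2]real_normK ?num_real // lerXn2r ?nnegrE //.
  exact: le_trans xi.
move: F0; rewrite /interior /= => /nbhs_ballP[e /= e0 he].
pose y : 'rV[R]_n := const_mx (e / 2).
have Fy : F y.
  apply: he; split=> // i j; rewrite /ball /= !mxE sub0r normrN gtr0_norm ?divr_gt0 //; lra.
have y0 : y != 0.
  apply/eqP => /rowP/(_ (Ordinal n0)); rewrite !mxE => h; move: e0; lra.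
move: Fy; rewrite AF => -[x Ax hx]; exists x => //; apply: enorm_gt0.
apply: contra_neq y0 => x0; move: hx; rewrite /petal /= x0 scaler0 subr0 enorm0 mul0r => h.
by apply: enorm_eq0; apply/eqP; rewrite eq_le h enorm_ge0.
Qed.

Theorem theorem6p1 (R : realType) (eps : R) (heps : 0 < eps) :
  exists2 c : R, 0 < c &
    forall (n : nat) (F : set 'rV[R]_n),
      (1 <= n)%N -> flower F -> F = [set - x | x in F] ->
      exists E : {vspace 'rV[R]_n},
        c * n%:R <= (\dim E)%:R /\
        (geom_dist (orth_proj_image E F) (eball E) <= (1 + eps)%:E)%E.
Proof.
(* The constant 17 gives 1 + d <= (1 + eps) (1 - 8 d), with equality at eps = 1. *)
pose d := Num.min eps 1 / 17.
have m0 : 0 < Num.min eps 1 by rewrite lt_min heps ltr01.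
have m1 : Num.min eps 1 <= 1 by rewrite ge_min lexx orbT.
have me : Num.min eps 1 <= eps by rewrite ge_min lexx.
have d0 : 0 < d <= 1 / 17 by apply/andP; split; rewrite /d; lra.
have [|c c0 hc] := dvoretzky d; first by move: d0; lra.
exists c => // n F n1 [[A AF] Fc F0] FN.
have [[B AB] [x0 Ax0 x0p]] := flower_points A F n1 AF Fc F0.
have A0 : A !=set0 by exists x0.
pose r := sup [set enorm x | x in A].
have r0 : 0 < r.
  apply: lt_le_trans x0p _; apply: ub_le_sup; last by exists x0.
  by exists B => _ [x Ax <-]; apply: AB.
pose q th := r^-1 * flower_gauge A th.
have gs := flower_gauge_seminorm A B A0 AB.
have qs : seminorm q.
  split=> [x y|a x]; rewrite /q.
    by rewrite -mulrDr ler_wpM2l ?invr_ge0 ?(ltW r0) // gs.1.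
  by rewrite gs.2; ring.
have [|E [rho [dimE E0 rho0 hE]]] := hc n q n1 qs.
  move=> x; have := flower_gauge_bounds A B A0 AB x; rewrite -/r /= => /andP[h1 h2].
  rewrite /q ler_pdivlMl // ler_pdivrMl // h1 /=.
  by apply: le_trans h2 _; rewrite mulrCA.
exists E; split => //.
apply: (flower_geom_dist A F B A0 AB AF FN E (r * rho) d) => //.
- by rewrite mulr_gt0.
- move=> x /hE; rewrite /q ler_pdivlMl // ler_pdivrMl // => /andP[h1 h2].
  apply/andP; split; [move: h1|move: h2]; clear; lra.
rewrite /d; have [h|h] := leP eps 1.
  by move: h heps; clear; nra.
by move: h heps; clear; lra.
Qed.
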